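(* Let $X(t,x)=\int_0^t\int_0^1G_{t-s}(x,y)\,B(ds,dy)$ be the solution of the fractional stochastic heat equation on $[0,T]\times[0,1]$ with Dirichlet boundary conditions and null initial condition. Then $X$ can be written, for $t\in[0,T]$, $x\in[0,1]$, as $$X(t,x)=\int_0^t\int_0^1M_{t,s}(x,y)\,W(ds,dy),$$ with $$M_{t,s}(x,y)=\int_s^tG_{t-u}(x,y)\,\partial_uK_H(u,s)\,du .$$
   Context: Fix $T>0$ and $H\in(\frac12,1)$. Let $W$ be a two-parameter Wiener process (Brownian sheet) on $[0,T]\times[0,1]$, defined on a complete probability space $(\Omega,\mathcal F,P)$. For $0<s\le t$, $$K_H(t,s)=C_H s^{\frac12-H}\int_s^t(u-s)^{H-\frac32}u^{H-\frac12}\,du,$$ where $C_H>0$ is the constant for which $\int_0^{s\wedge t}K_H(t,u)K_H(s,u)\,du=H(2H-1)\int_0^t\int_0^s|u-r|^{2H-2}\,du\,dr$. The noise is $B(t,x)=\int_0^t\int_0^xK_H(t,s)\,W(ds,dy)$. Put $B(1_{[0,t]\times[0,x]})=B(t,x)$; the Wiener integral $\varphi\mapsto B(\varphi)$ is the linear isometric extension to the Hilbert space $\mathcal H_T$ obtained by completing the step functions on $[0,T]\times[0,1]$ for the inner product $H(2H-1)\int_0^T\int_0^T\int_0^1\varphi(s,y)|s-r|^{2H-2}\psi(r,y)\,dy\,ds\,dr=E[B(\varphi)B(\psi)]$. It contains all measurable $\varphi$ for which $\int_0^T\int_0^T\int_0^1|\varphi(s,y)||s-r|^{2H-2}|\varphi(r,y)|\,dy\,ds\,dr<\infty$.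 One writes $\int_0^t\int_0^1\varphi(s,y)\,B(ds,dy)=B(1_{[0,t]}\varphi)$. $G_t(x,y)=\frac{1}{\sqrt{4\pi t}}\sum_{n=-\infty}^{\infty}\big[e^{-(y-x-2n)^2/(4t)}-e^{-(y+x-2n)^2/(4t)}\big]$ is the Dirichlet heat kernel on $[0,1]$. The equation solved by $X$ is $\partial_tX=\Delta X+B(dt,dx)$, $X(0,x)=0$, $X(t,0)=X(t,1)=0$. *)

(* Defs.v *)
From HB Require Import structures.
From mathcomp Require Import all_boot all_order all_algebra.
From mathcomp Require Import all_classical all_reals all_analysis.

Set Implicit Arguments.
Unset Strict Implicit.
Unset Printing Implicit Defensive.

Import Order.TTheory GRing.Theory Num.Theory.
Import numFieldTopology.Exports numFieldNormedType.Exports.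

Local Open Scope classical_set_scope.
Local Open Scope ring_scope.

Section Kernels.
Variable R : realType.
Local Notation mu := (@lebesgue_measure R).

(* Two-sided series as the sum of the series over n >= 0 and the series over
   n < 0 ([Negz k] is the integer -(k+1)). *)
Definition bilateral_sum (a : int -> R) : R :=
  limn (series (fun k : nat => a (Posz k))) +
  limn (series (fun k : nat => a (Negz k))).

Definition heat_kernel (t x y : R) : R :=
  (Num.sqrt (4 * pi * t))^-1 *
  bilateral_sum (fun n : int =>
    expR (- (y - x - 2 * n%:~R) ^+ 2 / (4 * t)) -
    expR (- (y + x - 2 * n%:~R) ^+ 2 / (4 * t))).

(* Meaningful for 0 < s <= t; the value is 0 when t < s and when s = 0. *)
Definition KH (CH H t s : R) : R :=
  CH * s `^ (2^-1 - H) *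
  \int[mu]_(u in `[s, t]) ((u - s) `^ (H - 3 / 2) * u `^ (H - 2^-1)).

Definition KH_normalization (CH H : R) : Prop :=
  0 < CH /\
  forall s t : R, 0 <= s -> 0 <= t ->
  (\int[mu]_(u in `[0%R, Num.min s t]) (KH CH H t u * KH CH H s u)%:E =
   (H * (2 * H - 1))%:E *
     \int[mu]_(r in `[0%R, t]) \int[mu]_(u in `[0%R, s])
        (`|u - r| `^ (2 * H - 2))%:E)%E.

Definition Mkernel (CH H t s x y : R) : R :=
  \int[mu]_(u in `[s, t])
     (heat_kernel (t - u) x y * derive1 (fun v : R => KH CH H v s) u).

End Kernels.

Section Integrands.
Variable R : realType.
Local Notation mu := (@lebesgue_measure R).
Implicit Types (T H : R) (f g : R * R -> R).

Definition domainT T : set (R * R) := `[0, T] `*` `[0, 1].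

Definition L2_sqnorm T f : \bar R :=
  (\int[mu]_(s in `[0%R, T]) \int[mu]_(y in `[0%R, 1%R])
     ((f (s, y)) ^+ 2)%:E)%E.

Definition in_L2 T f : Prop :=
  measurable_fun (domainT T) f /\ (L2_sqnorm T f < +oo)%E.

Definition HT_inner H T f g : \bar R :=
  ((H * (2 * H - 1))%:E *
   \int[mu]_(r in `[0%R, T]) \int[mu]_(s in `[0%R, T])
   \int[mu]_(y in `[0%R, 1%R])
     (f (s, y) * `|s - r| `^ (2 * H - 2) * g (r, y))%:E)%E.

Definition HT_sqnorm H T f : \bar R := HT_inner H T f f.

(* The measurable functions that the Hilbert space H_T is known to contain. *)
Definition in_HT H T f : Prop :=
  measurable_fun (domainT T) f /\
  (\int[mu]_(r in `[0%R, T]) \int[mu]_(s in `[0%R, T])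
   \int[mu]_(y in `[0%R, 1%R])
     (`|f (s, y)| * `|s - r| `^ (2 * H - 2) * `|f (r, y)|)%:E < +oo)%E.

(* A list of triples (a, t, x) stands for the step function
   sum_i a_i 1_{[0,t_i] x [0,x_i]}. *)
Definition step_on T (st : seq (R * R * R)) : Prop :=
  forall a t x, (a, t, x) \in st -> (t, x) \in domainT T.

Definition step_fun (st : seq (R * R * R)) (z : R * R) : R :=
  \sum_(p <- st) p.1.1 * (\1_(`[0, p.1.2] `*` `[0, p.2]) z : R).

End Integrands.

Section WienerIntegrals.
Context {R : realType} {d : measure_display} {Omega : measurableType d}
        (P : probability Omega R).
Implicit Types (N : R -> R -> {RV P >-> R}) (T H : R).

Definition step_integral N (st : seq (R * R * R)) (w : Omega) : R :=
  \sum_(p <- st) p.1.1 * N p.1.2 p.2 w.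

(* [normal_prob 0 0] is not the Dirac mass at 0, hence the separate case. *)
Definition centered_normal (Z : Omega -> R) : Prop :=
  {ae P, forall w, Z w = 0} \/
  exists2 sigma : R, 0 < sigma &
    forall A : set R, measurable A -> P (Z @^-1` A) = normal_prob 0 sigma A.

Definition brownian_sheet T (W : R -> R -> {RV P >-> R}) : Prop :=
  [/\ forall st, step_on T st -> centered_normal (step_integral W st),
      forall s x t y, (s, x) \in domainT T -> (t, y) \in domainT T ->
        ('E_P[(fun w => W s x w * W t y w)%R])%E
          = (Num.min s t * Num.min x y)%:E &
      {ae P, forall w,
         {within domainT T, continuous (fun z : R * R => W z.1 z.2 w)}}].

(* Z is the value at f of the extension by continuity of the map sending the
   step function 1_{[0,t] x [0,x]} to N t x: a limit in L^2(P) of the integrals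
   of step functions converging to f for the seminorm whose square is q. *)
Definition is_wiener_integral T (q : (R * R -> R) -> \bar R) N
    (f : R * R -> R) (Z : {RV P >-> R}) : Prop :=
  exists st : nat -> seq (R * R * R),
  [/\ forall n, step_on T (st n),
      q (fun z => step_fun (st n) z - f z) @[n --> \oo] --> 0%E &
      ('E_P[(fun w => (step_integral N (st n) w - Z w) ^+ 2)%R])%E
        @[n --> \oo] --> 0%E].

Definition sheet_integral T W (IW : (R * R -> R) -> {RV P >-> R}) : Prop :=
  forall f, in_L2 T f -> is_wiener_integral T (@L2_sqnorm R T) W f (IW f).

Definition noise_integral H T B (IB : (R * R -> R) -> {RV P >-> R}) : Prop :=
  forall f, in_HT H T f -> is_wiener_integral T (HT_sqnorm H T) B f (IB f).

End WienerIntegrals.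

(* Main.v *)
From HB Require Import structures.
Require Import Defs.
From mathcomp Require Import all_boot all_order all_algebra.
From mathcomp Require Import all_classical all_reals all_analysis.
From mathcomp Require Import measurable_realfun.
From mathcomp Require Import ring lra zify.

(* Write k(u, s) for the derivative of K_H(., s) at u, extended by 0 off
   0 < s < u, and K*f(s, y) for the integral of f(u, y) k(u, s) du.  The
   normalization of C_H says that the densities of (u, v) given by the integral
   of k(u, s) k(v, s) ds and by H(2H-1)|u - v|^(2H-2) have the same integral over
   every rectangle with corner 0, so they agree almost everywhere.  By Tonelli's
   theorem K* is then an isometry from H_T into L^2.  It sends 1_[0,t]x[0,x] to
   1_[0,t]x[0,x] K_H(t, .), which is the integrand defining B(t, x), and it sends
   the heat kernel G to M.  If step functions s_n converge to G in H_T, then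
   B(s_n) = W(K* s_n) converges both to B(G) and to W(M).  That G belongs to H_T
   follows from G being square integrable, since |s - r|^(2H-2) has bounded
   marginals. *)

Set Implicit Arguments.
Unset Strict Implicit.
Unset Printing Implicit Defensive.

Import Order.TTheory GRing.Theory Num.Theory.
Import numFieldTopology.Exports numFieldNormedType.Exports.

Local Open Scope classical_set_scope.
Local Open Scope ring_scope.

(** * Integrals of powers *)

Section PowerIntegrals.
Variable R : realType.
Local Notation mu := (@lebesgue_measure R).
Implicit Types (a c e p q u L : R).

(** Tonelli's theorem gives the isometry for nonnegative integrands only, with values in [0, +oo]. A
    signed phi is split into its positive and negative parts and the four resulting products are
    recombined. This is legitimate once |phi| has finite energy, which for the differences s_n - G
    follows from square integrability. K* phi is then finite only almost everywhere, and is handled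
    through [fine].

    The maps [IW] and [IB] are given only through L^2 limits of step integrals, one integrand at a
    time; neither linearity nor an isometry is assumed of them. Both properties are recovered on the
    level of limits, the isometry only up to a factor 4. That is enough, since it is applied to
    norms that tend to 0.

    Square integrability of G comes from trading part of the Gaussian decay for powers: G_a(x,y)^2
    <= C a^(-3/4) |y-x|^(-1/2), where both exponents exceed -1. *)

Lemma is_derive_powR_affine a c e u : a + 1 != 0 -> e ^+ 2 = 1 ->
  0 < e * (u - c) ->
  is_derive u (1 : R) (fun v : R => e / (a + 1) * (e * (v - c)) `^ (a + 1))
    ((e * (u - c)) `^ a).
Proof.
move=> a1 e2 eu.
have H1 : is_derive u (1 : R) (fun v : R => e * (v - c)) e.
  by apply: is_derive_eq; rewrite subr0 -[_ *: _]/(_ * _) mulr1.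
have H2 := @is_derive1_comp _ (fun x : R => x `^ (a + 1)) (fun v => e * (v - c)) _ _ _
  (is_derive1_powR (a + 1) eu) H1.
apply: is_derive_eq.
set X := _ `^ _; set Y := _ `^ a; have -> : X = Y by rewrite /X /Y /= addrK.
rewrite -[_ *: _]/(_ * _) (_ : e / (a + 1) * _ = e ^+ 2 * Y); last by field.
by rewrite e2 mul1r.
Qed.

(** The sign [e] lets one formula serve both sides of the singularity [c]: e = 1 to the right of it,
    e = -1 to the left. *)
Lemma integral_powR_affine a c e p q : a + 1 != 0 -> e ^+ 2 = 1 -> p < q ->
  (forall u, u \in `[p, q] -> 0 < e * (u - c)) ->
  (\int[mu]_(u in `[p, q]) ((e * (u - c)) `^ a)%:E =
   (e / (a + 1) * ((e * (q - c)) `^ (a + 1) - (e * (p - c)) `^ (a + 1)))%:E)%E.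
Proof.
move=> a1 e2 pq epos.
pose F (v : R) := e / (a + 1) * (e * (v - c)) `^ (a + 1).
have dF u : u \in `[p, q] -> is_derive u (1 : R) F ((e * (u - c)) `^ a).
  by move=> /epos; exact: is_derive_powR_affine.
rewrite (@continuous_FTC2 _ _ F)//.
- by rewrite -EFinB mulrBr.
- apply: derivable_within_continuous => u uin.
  have dd : is_derive u (1 : R) (fun v : R => e * (v - c)) e.
    by apply: is_derive_eq; rewrite subr0 -[_ *: _]/(_ * _) mulr1.
  have := @is_derive1_comp _ (fun x : R => x `^ a) (fun v => e * (v - c)) _ _ _
    (is_derive1_powR a (epos u uin)) dd.
  by move=> [].
- have cF u : u \in `[p, q] -> {for u, continuous F}.
    by move=> /dF[+ _] => /derivable1_diffP; exact: differentiable_continuous.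
  split.
  + by move=> u /subset_itv_oo_cc/dF[].
  + by apply: cvg_at_right_filter; apply: cF; rewrite in_itv/= lexx ltW.
  + by apply: cvg_at_left_filter; apply: cF; rewrite in_itv/= lexx ltW.
- by move=> u /subset_itv_oo_cc/dF[_]; rewrite derive1E.
Qed.

(** Both endpoint values of the antiderivative lie between 0 and L^(a+1)/(a+1) in absolute value, so
    the bound does not degrade as the interval approaches [c]. *)
Lemma integral_powR_affine_le a c e p q L : -1 < a -> e ^+ 2 = 1 -> p <= q ->
  (forall u, u \in `[p, q] -> 0 < e * (u - c) <= L) ->
  (\int[mu]_(u in `[p, q]) (`|u - c| `^ a)%:E <= (L `^ (a + 1) / (a + 1))%:E)%E.
Proof.
move=> a1; rewrite le_eqVlt => e2 /orP[/eqP <-|pq] epos.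
  rewrite set_itv1 integral_set1 lee_fin divr_ge0 ?powR_ge0//; lra.
have e1 : `|e| = 1 by apply/eqP; rewrite -sqrp_eq1// -normrX e2 normr1.
have -> : (\int[mu]_(u in `[p, q]) (`|u - c| `^ a)%:E =
           \int[mu]_(u in `[p, q]) ((e * (u - c)) `^ a)%:E)%E.
  apply: eq_integral => u; rewrite inE/= => /epos/andP[eu _].
  by rewrite -[e * _]gtr0_norm// normrM e1 mul1r.
rewrite integral_powR_affine//; [|lra|by move=> u /epos/andP[]].
rewrite lee_fin.
have pin : p \in `[p, q] by rewrite in_itv/= lexx ltW.
have qin : q \in `[p, q] by rewrite in_itv/= lexx ltW.
have /andP[p0 pL] := epos _ pin; have /andP[q0 qL] := epos _ qin.
have hp : (e * (p - c)) `^ (a + 1) <= L `^ (a + 1).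
  by apply: ge0_ler_powR; rewrite ?nnegrE//; lra.
have hq : (e * (q - c)) `^ (a + 1) <= L `^ (a + 1).
  by apply: ge0_ler_powR; rewrite ?nnegrE//; lra.
have hp0 := powR_ge0 (e * (p - c)) (a + 1).
have hq0 := powR_ge0 (e * (q - c)) (a + 1).
rewrite mulrAC ler_pM2r ?invr_gt0; last lra.
move: hp hq hp0 hq0; set X := _ `^ _; set Y := (e * _) `^ _ => *.
have /orP[/eqP->|/eqP->] : (e == 1) || (e == -1) by rewrite -sqrf_eq1 e2.
  lra.
lra.
Qed.

Let natSinv_gt0 (n : nat) : (0 : R) < n.+1%:R^-1.
Proof. by rewrite invr_gt0. Qed.

(** The interval without [c] is exhausted by [A n] and [B n], the parts at distance at least 1/(n+1)
    to the right and to the left of [c]. Each contributes at most [K], uniformly in n, and monotone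
    convergence concludes; the 2 counts the sides. *)
Lemma integral_norm_powR_le a c p q : -1 < a -> a != 0 -> c \in `[p, q] ->
  (\int[mu]_(u in `[p, q]) (`|u - c| `^ a)%:E <=
   (2 * ((q - p) `^ (a + 1) / (a + 1)))%:E)%E.
Proof.
move=> a1 a0; rewrite in_itv/= => /andP[pc cq].
set K := _ / _.
have mf (D : set R) : measurable_fun D (EFin \o (fun u : R => `|u - c| `^ a)).
  apply/measurable_EFinP; apply: measurable_funTS.
  apply: (measurableT_comp (measurable_powR _)).
  by apply: measurableT_comp => //; exact: measurable_funD.
have f0 (u : R) : (0 <= (`|u - c| `^ a)%:E)%E by rewrite lee_fin powR_ge0.
pose A n := `[c + n.+1%:R^-1, q]%classic.
pose B n := `[p, c - n.+1%:R^-1]%classic.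
have K0 : 0 <= K by rewrite divr_ge0 ?powR_ge0//; lra.
have IA n : (\int[mu]_(u in A n) (`|u - c| `^ a)%:E <= K%:E)%E.
  have n0 : (0 : R) < n.+1%:R^-1 by rewrite invr_gt0.
  have [h|h] := leP (c + n.+1%:R^-1) q; last first.
    by rewrite /A set_itv_ge ?integral_set0// bnd_simp -ltNge.
  apply: (@integral_powR_affine_le _ _ 1) => //; first by rewrite expr1n.
  move: (n.+1%:R^-1) n0 h => e n0 h u; rewrite in_itv/= => /andP[h1 h2]. by apply/andP; split; lra.
have IB n : (\int[mu]_(u in B n) (`|u - c| `^ a)%:E <= K%:E)%E.
  have n0 : (0 : R) < n.+1%:R^-1 by rewrite invr_gt0.
  have [h|h] := leP p (c - n.+1%:R^-1); last first.
    by rewrite /B set_itv_ge ?integral_set0// bnd_simp -ltNge.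
  apply: (@integral_powR_affine_le _ _ (-1)) => //; first by rewrite sqrrN expr1n.
  move: (n.+1%:R^-1) n0 h => e n0 h u; rewrite in_itv/= => /andP[h1 h2]. by apply/andP; split; lra.
have mAB n : measurable (A n `|` B n).
  by apply: measurableU; exact: measurable_itv.
have nd : nondecreasing_seq (fun n => A n `|` B n).
  move=> n m nm; apply/subsetPset.
  have nmR : (m.+1%:R^-1 : R) <= n.+1%:R^-1.
    by rewrite lef_pV2 ?posrE// ler_nat ltnS.
  apply: setUSS => u; rewrite /A /B /= !in_itv/= => /andP[h1 h2].
    by rewrite h2 andbT (le_trans _ h1)// lerD2l.
  by rewrite h1 (le_trans h2)// lerD2l lerN2.
have UAB : (\bigcup_n (A n `|` B n)) = `[p, q] `\ c.
  apply/seteqP; split => u /=.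
    move=> [n _ [|]]; rewrite /A /B /= in_itv/= => /andP[h1 h2];
      move: (n.+1%:R^-1) (natSinv_gt0 n) h1 h2 => e e0 h1 h2;
      rewrite in_itv/=; split; try (by apply/andP; split; lra).
    - by apply/eqP; rewrite gt_eqF//; lra.
    - by apply/eqP; rewrite lt_eqF//; lra.
  rewrite in_itv/= => -[/andP[h1 h2] /eqP uc].
  have du : 0 < `|u - c| by rewrite normr_gt0 subr_eq0.
  have [n _ hn] := @near_infty_natSinv_lt R (PosNum du).
  exists n => //; rewrite /A /B /= !in_itv/=.
  have := hn n (leqnn _); rewrite /=; move: (n.+1%:R^-1) => e.
  have [|] := ltP u c => h hh; [right|left]; apply/andP; split => //; move: hh.
    by rewrite ltr0_norm ?subr_lt0// => ?; lra.
  by rewrite ger0_norm ?subr_ge0// => ?; lra.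
rewrite -(@integral_setD1 _ _ c) -?UAB//; last first.
  by apply: bigcupT_measurable.
have cv := @ge0_nondecreasing_set_cvg_integral _ _ _ _ _ mu nd mAB
  (fun i => mf _) (fun i x _ => f0 x).
rewrite -(cvg_lim _ cv)//; apply: lime_le; first by apply/cvg_ex; eexists; exact: cv.
apply: nearW => n.
rewrite ge0_integral_setU; [|exact: measurable_itv|exact: measurable_itv|exact: mf|by move=> *; exact: f0|].
  by rewrite mulr2n mulrDl mul1r EFinD; apply: leeD; [exact: IA|exact: IB].
apply/disj_setPRL => u; rewrite /A /B /= !in_itv/= => /andP[h1 h2] /andP[h3 h4].
by move: (n.+1%:R^-1) (natSinv_gt0 n) h2 h3 => e e0 h1' h2'; lra.
Qed.

End PowerIntegrals.

(** * The derivative of the kernel K_H *)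

Section KernelDerivative.
Variable R : realType.
Local Notation mu := (@lebesgue_measure R).
Variables CH H : R.
Hypotheses (CH0 : 0 < CH) (H12 : 2^-1 < H) (H1 : H < 1).
Implicit Types s t u v : R.

(* The derivative of K_H(., s) at u, extended by 0 off 0 < s < u. *)
Definition dKH u s : R :=
  if (0 < s < u) then
    CH * s `^ (2^-1 - H) * ((u - s) `^ (H - 3 / 2) * u `^ (H - 2^-1))
  else 0.

Lemma dKH_ge0 u s : 0 <= dKH u s.
Proof. by rewrite /dKH; case: ifP => // _; rewrite !mulr_ge0 ?powR_ge0// ltW. Qed.

Lemma measurable_dKH : measurable_fun setT (fun z : R * R => dKH z.1 z.2).
Proof.
have ms (a : R) : measurable_fun setT (fun z : R * R => z.2 `^ a).
  exact: (measurableT_comp (measurable_powR _)).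
apply: measurable_fun_ifT => //=.
  by apply: measurable_and; apply: measurable_fun_ltr.
apply: measurable_funM.
  by apply: measurable_funM => //; exact: ms.
apply: measurable_funM.
  by apply: (measurableT_comp (measurable_powR _)); exact: measurable_funB.
exact: (measurableT_comp (measurable_powR _)).
Qed.

Definition KH_integrand s u : R := (u - s) `^ (H - 3 / 2) * u `^ (H - 2^-1).

Lemma measurable_KH_integrand s D : measurable_fun D (KH_integrand s).
Proof.
apply: measurable_funTS; apply: measurable_funM.
  by apply: (measurableT_comp (measurable_powR _)); exact: measurable_funB.
exact: (measurable_powR _).
Qed.

(** The factor u^(H-1/2) is at most t^(H-1/2) because H > 1/2, and the remaining singularity at s is
    integrable because H - 3/2 > -1. *)
Lemma integrable_KH_integrand s t : 0 <= s -> s <= t -> mu.-integrable `[s, t] (EFin \o KH_integrand s).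
Proof.
have := H12; have := H1 => H1' H12'.
move=> s0 st.
have st1 : s \in `[s, t] by rewrite in_itv/= lexx.
have h0 : H - 3 / 2 != 0 by apply/eqP => ?; lra.
have h1 : -1 < H - 3 / 2 by lra.
have := integral_norm_powR_le h1 h0 st1.
set K := (_ `^ _ / _) => hK.
apply/integrableP; split; first by apply: measurableT_comp => //; exact: measurable_KH_integrand.
apply: (@le_lt_trans _ _ (\int[mu]_(u in `[s, t])
   ((t `^ (H - 2^-1))%:E * (`|u - s| `^ (H - 3 / 2))%:E))%E).
  apply: ge0_le_integral => //=.
  - by do 2 apply: measurableT_comp => //; exact: measurable_KH_integrand.
  - apply: emeasurable_funM => //; apply/measurable_EFinP.
    apply: (measurableT_comp (measurable_powR _)).
    by apply: measurableT_comp => //; exact: measurable_funB.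
  - move=> u; rewrite in_itv/= => /andP[su ut].
    rewrite -EFinM lee_fin /KH_integrand ger0_norm ?mulr_ge0 ?powR_ge0//.
    rewrite [(`|_|)]ger0_norm ?subr_ge0// mulrC ler_wpM2r ?powR_ge0//.
    by apply: ge0_ler_powR; rewrite ?nnegrE; lra.
rewrite ge0_integralZl ?lee_fin ?powR_ge0//.
- apply: (@le_lt_trans _ _ ((t `^ (H - 2^-1))%:E * (2 * K)%:E)%E).
    by apply: lee_wpmul2l => //; rewrite lee_fin powR_ge0.
  by rewrite -EFinM ltry.
- apply/measurable_EFinP; apply: (measurableT_comp (measurable_powR _)).
  by apply: measurableT_comp => //; exact: measurable_funB.
Qed.

Lemma KH_lt t s : t < s -> KH CH H t s = 0.
Proof.
by move=> ts; rewrite /KH set_itv_ge ?Rintegral_set0 ?mulr0// bnd_simp -ltNge.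
Qed.

(** Extending the derivative by 0 makes the interval of integration independent of s, so that s can
    later be integrated out by Tonelli. *)
Lemma KH_integral t s : 0 <= s ->
  ((KH CH H t s)%:E = \int[mu]_(u in `[0%R, t]) (dKH u s)%:E)%E.
Proof.
have := H12; have := H1 => H1' H12'.
rewrite le_eqVlt => /predU1P[<-|s0].
  (* A power of 0 with nonzero exponent is 0, so both sides vanish at s = 0. *)
  rewrite /KH powR0 ?mulr0 ?mul0r; last by apply/eqP => ?; lra.
  by rewrite integral0_eq// => u _; rewrite /dKH ltxx.
have [ts|st] := ltP t s.
  rewrite KH_lt// integral0_eq// => u /=; rewrite in_itv/= => /andP[_ ut].
  by rewrite /dKH [s < u]ltNge (ltW (le_lt_trans ut ts)) andbF.
have intg := integrable_KH_integrand (ltW s0) st.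
rewrite /KH -[X in _ * X]/(\int[mu]_(u in `[s, t]) KH_integrand s u).
rewrite EFinM /Rintegral fineK; last exact: integrable_fin_num.
rewrite -ge0_integralZl//=; last 3 first.
- by apply: measurableT_comp => //; exact: measurable_KH_integrand.
- by move=> u _; rewrite lee_fin mulr_ge0 ?powR_ge0.
- by rewrite lee_fin mulr_ge0 ?powR_ge0// ltW.
rewrite [LHS]integral_mkcond [RHS]integral_mkcond.
apply: eq_integral => u _; rewrite !patchE !mem_setE !in_itv/= /dKH s0/=.
have [ut|ut] := leP u t; last by rewrite !andbF.
rewrite !andbT; have [us|us|us] := ltgtP s u.
- by rewrite (le_trans (ltW s0) (ltW us)) /KH_integrand.
- by case: ifP.
(* At u = s the singular power is a power of 0, hence 0, which agrees with the strict inequality in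
   [dKH]. *)
- rewrite us (le_trans (ltW s0)) ?us// /KH_integrand subrr powR0 ?mul0r ?mule0 ?if_same//.
  by apply/eqP => ?; lra.
Qed.

Lemma derive1_KH u s : 0 <= s -> s < u ->
  derive1 (fun v : R => KH CH H v s) u = dKH u s.
Proof.
have := H12; have := H1 => H1' H12'.
rewrite le_eqVlt => /predU1P[<-|s0] su.
  rewrite /dKH ltxx (_ : (fun v => _) = cst 0) ?derive1_cst//.
  apply/funext => v; rewrite /KH powR0 ?mulr0 ?mul0r//.
  by apply/eqP => ?; lra.
rewrite /dKH s0 su/=.
have cg : {for u, continuous (KH_integrand s)}.
  apply: differentiable_continuous; apply/derivable1_diffP.
  apply: derivableM; last by apply: derivable_powR; rewrite in_itv/= andbT (lt_trans s0).
  have H0 : is_derive u (1 : R) (fun v : R => v - s) 1.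
    by apply: is_derive_eq; rewrite subr0.
  have su' : 0 < u - s by rewrite subr_gt0.
  by have [] := @is_derive1_comp _ (fun x : R => x `^ (H - 3 / 2))
    (fun v => v - s) _ _ _ (is_derive1_powR (H - 3 / 2) su') H0.
(* The fundamental theorem of calculus is applied on [s, u + 1], so that u is an interior point; the
   integrand is continuous there since u > s. *)
have uu : u < u + 1 by rewrite ltrDl.
have su1 : s <= u + 1 by rewrite ltW// (lt_trans su).
have [dF FE] := continuous_FTC1_closed uu (integrable_KH_integrand (ltW s0) su1) su cg.
rewrite /KH derive1E.
rewrite (_ : (fun v => _) = (CH * s `^ (2^-1 - H)) \*:
  (fun v => \int[mu]_(w in `[s, v]) KH_integrand s w))//.
by rewrite deriveZ// -derive1E FE.
Qed.

End KernelDerivative.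

(** * Measures on the plane and iterated integrals *)

Section MeasureTools.
Local Open Scope ereal_scope.

Section Density.
Context d (T : measurableType d) (R : realType) (mu : {measure set T -> \bar R}).
Variable h : T -> \bar R.
Hypotheses (mh : measurable_fun setT h) (h0 : forall x, 0 <= h x).

(** The two proofs are arguments so that the measure structure declared below can be inferred from
    the term itself. *)
Definition density (_ : measurable_fun setT h) (_ : forall x, 0 <= h x) (A : set T) :=
  \int[mu]_(x in A) h x.

Let density0 : density mh h0 set0 = 0.
Proof. exact: integral_set0. Qed.

Let density_ge0 A : 0 <= density mh h0 A.
Proof. by apply: integral_ge0 => x _; exact: h0. Qed.

Let density_sigma_additive : semi_sigma_additive (density mh h0).
Proof.
move=> A mA tA mUA; rewrite /density ge0_integral_bigcup//; last first.
  exact: measurable_funTS.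
apply: is_cvg_ereal_nneg_natsum_cond => n _ _.
exact: integral_ge0.
Qed.

HB.instance Definition _ := isMeasure.Build _ _ _
  (density mh h0) density0 density_ge0 density_sigma_additive.
End Density.

Section PlaneRays.
Variable R : realType.
Local Notation mu := (@lebesgue_measure R).

Definition plane_rays : set (set (R * R)) :=
  [set A | exists a b : R, A = `]-oo, a] `*` `]-oo, b]].

(** Both coordinates are measurable for the sigma-algebra generated by the quadrants, carried by the
    type [GT]. Hence so is the identity map from [GT] to the plane, which is the nontrivial
    inclusion. *)
Lemma measurable_plane_rays : @measurable _ (R * R)%type = <<s plane_rays >>.
Proof.
apply/seteqP; split; last first.
  apply: smallest_sub; first exact: sigma_algebra_measurable.
  by move=> _ [a [b ->]]; apply: measurableX; exact: measurable_itv.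
pose GT := g_sigma_algebraType plane_rays.
have m1 : measurable_fun [set: GT] (fst : GT -> R).
  apply: (measurability _ (RGenOInfty.measurableE R)) => //.
  move=> _ [_ [x ->] <-]; rewrite setTI.
  (* A half-plane is the complement of the union of the quadrants whose other corner coordinate
     grows to infinity. *)
  rewrite (_ : _ @^-1` _ = ~` \bigcup_n (`]-oo, x] `*` `]-oo, n%:R])).
    apply: (@measurableC _ GT); apply: bigcupT_measurable => n.
    by apply: sub_sigma_algebra; exists x, n%:R.
  apply/seteqP; split => [[u v]|[u v]] /=; rewrite in_itv/= andbT.
    by move=> xu [n _ [/=]]; rewrite !in_itv/= => h h'; move: xu; rewrite ltNge ?h ?h'.
  move=> h; rewrite ltNge; apply/negP => ux; apply: h.
  exists (Num.trunc v).+1 => //; split; rewrite /= in_itv//=.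
  by rewrite ltW// truncnS_gt.
have m2 : measurable_fun [set: GT] (snd : GT -> R).
  apply: (measurability _ (RGenOInfty.measurableE R)) => //.
  move=> _ [_ [x ->] <-]; rewrite setTI.
  rewrite (_ : _ @^-1` _ = ~` \bigcup_n (`]-oo, n%:R] `*` `]-oo, x])).
    apply: (@measurableC _ GT); apply: bigcupT_measurable => n.
    by apply: sub_sigma_algebra; exists n%:R, x.
  apply/seteqP; split => [[u v]|[u v]] /=; rewrite in_itv/= andbT.
    by move=> xu [n _ [/=]]; rewrite !in_itv/= => h h'; move: xu; rewrite ltNge ?h ?h'.
  move=> h; rewrite ltNge; apply/negP => ux; apply: h.
  exists (Num.trunc u).+1 => //; split; rewrite /= in_itv//=.
  by rewrite ltW// truncnS_gt.
have mid : measurable_fun [set: GT] (fun z : GT => (z.1, z.2) : R * R).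
  exact: measurable_fun_pair.
move=> A mA; have := mid measurableT A mA; rewrite setTI.
by rewrite (_ : _ @^-1` A = A)//; apply/seteqP; split => -[].
Qed.

(** Pi-lambda uniqueness: quadrants are stable under intersection and exhaust the plane, and the
    second hypothesis supplies sigma-finiteness. *)
Lemma measure_unique_plane_rays 
    (m1 m2 : {measure set (measurableTypeR R * measurableTypeR R) -> \bar R}) :
  (forall a b : R, m1 (`]-oo, a] `*` `]-oo, b]) = m2 (`]-oo, a] `*` `]-oo, b])) ->
  (forall a : R, m1 (`]-oo, a] `*` `]-oo, a]) < +oo) ->
  forall A, measurable A -> m1 A = m2 A.
Proof.
move=> m12 m1oo.
apply: (@measure_unique _ _ (measurableTypeR R * measurableTypeR R)%type
  plane_rays (fun n => `]-oo, n%:R] `*` `]-oo, n%:R])).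
- exact: measurable_plane_rays.
- move=> _ _ [a [b ->]] [a' [b' ->]]; rewrite -setXI.
  by exists (Num.min a a'), (Num.min b b'); congr (_ `*` _);
  apply/seteqP; split => x /=; rewrite !in_itv/= le_min => /andP.
- by move=> n; exists n%:R, n%:R.
- apply/seteqP; split => // -[u v] _ /=.
  pose n := maxn (Num.trunc u).+1 (Num.trunc v).+1.
  exists n => //; split; rewrite /= in_itv/= ltW//.
    by rewrite (lt_le_trans (truncnS_gt u))// ler_nat leq_maxl.
  by rewrite (lt_le_trans (truncnS_gt v))// ler_nat leq_maxr.
- by move=> _ [a [b ->]]; exact: m12.
- by move=> n; exact: m1oo.
Qed.

End PlaneRays.

Lemma measurable_integral_param d1 d2 (T1 : measurableType d1)
   (T2 : measurableType d2) (R : realType)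
   (m2 : {sigma_finite_measure set T2 -> \bar R}) (B : set T2)
   (f : T1 * T2 -> \bar R) :
  measurable B -> measurable_fun setT f -> (forall z, 0 <= f z) ->
  measurable_fun setT (fun x => \int[m2]_(y in B) f (x, y)).
Proof.
move=> mB mf f0.
have mTB : measurable ([set: T1] `*` B) by exact: measurableX.
have mfB : measurable_fun setT (f \_ (setT `*` B)).
  by apply/(measurable_restrictT _ mTB); exact: measurable_funTS.
have fB0 z : 0 <= (f \_ (setT `*` B)) z by exact: erestrict_ge0.
apply: eq_measurable_fun (measurable_fun_fubini_tonelli_F (m2 := m2) _ mfB fB0).
move=> x _; rewrite /fubini_F [RHS]integral_mkcond; apply: eq_integral => y _.
by rewrite !patchE in_setX/= in_setT.
Qed.

Lemma integral_prod_mul d1 d2 (T1 : measurableType d1) (T2 : measurableType d2)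
   (R : realType)
   (m1 : {sigma_finite_measure set T1 -> \bar R})
   (m2 : {sigma_finite_measure set T2 -> \bar R})
   (f : T1 -> \bar R) (g : T2 -> \bar R) :
  measurable_fun setT f -> measurable_fun setT g ->
  (forall x, 0 <= f x) -> (forall x, 0 <= g x) ->
  \int[m1 \x m2]_z (f z.1 * g z.2) = \int[m1]_x f x * \int[m2]_y g y.
Proof.
move=> mf mg f0 g0.
rewrite fubini_tonelli1/=; last 2 first.
- by apply: emeasurable_funM; [exact: (measurableT_comp mf)|exact: (measurableT_comp mg)].
- by move=> z; rewrite mule_ge0.
rewrite /fubini_F/=; under eq_integral do rewrite ge0_integralZl//.
by rewrite ge0_integralZr// integral_ge0.
Qed.

Lemma measurable_pair2 (R : realType) (d : measure_display) (S : measurableType d)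
    (h : R * R -> R) (a b : S -> R) : measurable_fun setT h ->
  measurable_fun setT a -> measurable_fun setT b ->
  measurable_fun setT (fun w => h (a w, b w)).
Proof. by move=> mh ma mb; exact: (measurableT_comp mh (measurable_fun_pair ma mb)). Qed.

Section TwoProducts.
Context d1 d2 (T1 : measurableType d1) (T2 : measurableType d2) (R : realType).
Variable m1 : {sigma_finite_measure set T1 -> \bar R}.
Variable m2 : {sigma_finite_measure set T2 -> \bar R}.

(* A new name for [m1 \x m2]: no sigma-finite structure is inferred for the
   product itself, which would prevent iterating Tonelli's theorem. *)
Definition prod_measure : set (T1 * T2) -> \bar R := m1 \x m2.

Let prod_measure_sigma_finite : sigma_finite setT prod_measure.
Proof.
have /sigma_finiteP[F [TF ndF Foo]] := sigma_finiteT m1.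
have /sigma_finiteP[G [TG ndG Goo]] := sigma_finiteT m2.
exists (fun n => F n `*` G n).
  rewrite -setXTT TF TG predeqE => -[x y]; split.
    move=> [/= [n _ Fnx] [k _ Gky]]; exists (maxn n k) => //; split.
    - by move: x Fnx; exact/subsetPset/ndF/leq_maxl.
    - by move: y Gky; exact/subsetPset/ndG/leq_maxr.
  by move=> [n _ []/= ? ?]; split; exists n.
move=> k; have [? ?] := Foo k; have [? ?] := Goo k.
split; first exact: measurableX.
by rewrite /prod_measure product_measure1E// lte_mul_pinfty// ge0_fin_numE.
Qed.

HB.instance Definition _ := Measure.copy prod_measure (m1 \x m2).
HB.instance Definition _ :=
  Measure_isSigmaFinite.Build _ _ _ prod_measure prod_measure_sigma_finite.

End TwoProducts.

Lemma tonelli_prod d1 d2 d3 (T1 : measurableType d1) (T2 : measurableType d2)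
   (T3 : measurableType d3) (R : realType)
   (m1 : {sigma_finite_measure set T1 -> \bar R})
   (m2 : {sigma_finite_measure set T2 -> \bar R})
   (m3 : {sigma_finite_measure set T3 -> \bar R})
   (f : (T1 * T2) * T3 -> \bar R) :
  measurable_fun setT f -> (forall z, 0 <= f z) ->
  \int[m1 \x m2]_z \int[m3]_s f (z, s) = \int[m3]_s \int[m1 \x m2]_z f (z, s).
Proof. by move=> mf f0; exact: (fubini_tonelli (m1 := prod_measure m1 m2)). Qed.

Lemma tonelli_prod_prod d1 d2 d3 d4
   (T1 : measurableType d1) (T2 : measurableType d2)
   (T3 : measurableType d3) (T4 : measurableType d4) (R : realType)
   (m1 : {sigma_finite_measure set T1 -> \bar R})
   (m2 : {sigma_finite_measure set T2 -> \bar R})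
   (m3 : {sigma_finite_measure set T3 -> \bar R})
   (m4 : {sigma_finite_measure set T4 -> \bar R})
   (f : (T1 * T2) * (T3 * T4) -> \bar R) :
  measurable_fun setT f -> (forall z, 0 <= f z) ->
  \int[m1 \x m2]_z \int[m3 \x m4]_w f (z, w) =
  \int[m3 \x m4]_w \int[m1 \x m2]_z f (z, w).
Proof. by move=> mf f0; exact: (@tonelli_prod _ _ _ _ _ _ _ m1 m2 (prod_measure m3 m4)). Qed.

End MeasureTools.

(** * The covariance identity *)

Section CovarianceIdentity.
Local Open Scope ereal_scope.
Variable R : realType.
Local Notation mu := (@lebesgue_measure R).

Lemma integral_setX (A B : set R) (f : R * R -> \bar R) :
  measurable A -> measurable B ->
  measurable_fun setT f -> (forall z, 0 <= f z) ->
  \int[mu \x mu]_(z in A `*` B) f z =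
  \int[mu]_(x in A) \int[mu]_(y in B) f (x, y).
Proof.
move=> mA mB mf f0.
have mAB : measurable (A `*` B) by exact: measurableX.
rewrite integral_mkcond fubini_tonelli1; last 2 first.
- exact/(measurable_restrictT _ _).1/measurable_funTS.
- by move=> z; exact: erestrict_ge0.
rewrite [RHS]integral_mkcond; apply: eq_integral => x _.
rewrite /fubini_F/= patchE; case: ifPn => [xA|/negP xA].
  rewrite [RHS]integral_mkcond; apply: eq_integral => y _.
  by rewrite !patchE in_setX/= xA.
by rewrite integral0_eq// => y _; rewrite patchE in_setX/= (negbTE (introN idP xA)).
Qed.

Variables CH H T : R.
Hypotheses (CH0 : (0 < CH)%R) (H12 : (2^-1 < H)%R) (H1 : (H < 1)%R).

Definition dKH_cov (z : R * R) : \bar R :=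
  \int[mu]_s (dKH CH H z.1 s * dKH CH H z.2 s)%:E.

(** The mixed second derivative, off the diagonal, of the covariance of fractional Brownian motion
    of index H. *)
Definition riesz (z : R * R) : \bar R :=
  (H * (2 * H - 1))%:E * (`|z.2 - z.1| `^ (2 * H - 2))%:E.

Lemma riesz_cst_gt0 : (0 < H * (2 * H - 1))%R.
Proof. by have := H12 => h; rewrite mulr_gt0//; lra. Qed.

Lemma riesz_ge0 z : 0 <= riesz z.
Proof.
by rewrite mule_ge0// lee_fin ?powR_ge0// ltW// riesz_cst_gt0.
Qed.

Lemma measurable_norm_powR (a : R) :
  measurable_fun setT (fun z : R * R => (`|z.2 - z.1| `^ a)%:E).
Proof.
apply/measurable_EFinP; apply: (measurableT_comp (measurable_powR _)).
by apply: measurableT_comp => //; exact: measurable_funB.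
Qed.

Lemma measurable_riesz : measurable_fun setT riesz.
Proof. by apply: emeasurable_funM => //; exact: measurable_norm_powR. Qed.

Lemma measurable_dKH2 (d : measure_display) (S : measurableType d) (f g : S -> R) :
  measurable_fun setT f -> measurable_fun setT g ->
  measurable_fun setT (fun w => dKH CH H (f w) (g w)).
Proof.
move=> mf mg.
exact: (measurableT_comp (measurable_dKH CH H) (measurable_fun_pair mf mg)).
Qed.

Let measurable_dKH_dKH : measurable_fun setT
  (fun w : (R * R) * R => (dKH CH H w.1.1 w.2 * dKH CH H w.1.2 w.2)%:E).
Proof.
apply/measurable_EFinP; apply: measurable_funM; apply: measurable_dKH2 => //;
  exact: measurableT_comp.
Qed.

Lemma measurable_dKH_cov : measurable_fun setT dKH_cov.
Proof.
apply: (@measurable_fun_fubini_tonelli_F _ _ _ _ _ mu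
  (fun w : (R * R) * R => (dKH CH H w.1.1 w.2 * dKH CH H w.1.2 w.2)%:E)) => //.
by move=> w; rewrite lee_fin mulr_ge0// dKH_ge0.
Qed.

Lemma dKH_cov_ge0 z : 0 <= dKH_cov z.
Proof. by apply: integral_ge0 => s _; rewrite lee_fin mulr_ge0// dKH_ge0. Qed.

(** With s as the outer variable the integral over the rectangle factors, and each factor is a value
    of K_H. The minimum appears because K_H(a, s) vanishes for s > a. *)
Lemma integral_dKH_cov_rect a b : (0 <= a)%R -> (0 <= b)%R ->
  \int[mu \x mu]_(z in `[0%R, a] `*` `[0%R, b]) dKH_cov z =
  \int[mu]_(u in `[0%R, Num.min b a]) (KH CH H a u * KH CH H b u)%:E.
Proof.
move=> a0 b0.
pose F (a u s : R) : \bar R := (\1_(`[0%R, a]%classic) u * dKH CH H u s)%:E.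
have F0 x u s : 0 <= F x u s by rewrite lee_fin mulr_ge0// dKH_ge0.
have mF (d : measure_display) (S : measurableType d) (x : R) (f g : S -> R) :
  measurable_fun setT f -> measurable_fun setT g ->
  measurable_fun setT (fun w => F x (f w) (g w)).
  move=> mf mg; apply/measurable_EFinP/measurable_funM; last exact: measurable_dKH2.
  by apply: (measurableT_comp _ mf); exact: measurable_indic.
(* For s < 0 the formula [KH] does not represent the kernel, while [dKH] is 0; hence the two
   cases. *)
have F1 x s : (0 <= x)%R ->
    \int[mu]_u F x u s = if (0 <= s)%R then (KH CH H x s)%:E else 0.
  move=> x0; case: ifPn => s0.
    rewrite KH_integral// [RHS]integral_mkcond; apply: eq_integral => u _.
    rewrite /F patchE indicE; case: ifPn => ux; rewrite ?mul1r ?mul0r//.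
  rewrite integral0_eq// => u _; rewrite /F /dKH ltNge (_ : (s <= 0)%R) ?mulr0//.
  by rewrite ltW// ltNge.
rewrite integral_mkcond.
transitivity (\int[mu \x mu]_z \int[mu]_s (F a z.1 s * F b z.2 s)).
  apply: eq_integral => -[u v] _; rewrite patchE in_setX/=.
  rewrite /F; have [ua|ua] := boolP (u \in `[0%R, a]%classic); last first.
    by rewrite integral0_eq// => s _; rewrite indicE (negbTE ua) mul0r mul0e.
  have [vb|vb] := boolP (v \in `[0%R, b]%classic); last first.
    by rewrite integral0_eq// => s _; rewrite !indicE (negbTE vb) mul0r mule0.
  by apply: eq_integral => s _; rewrite !indicE ua vb !mul1r.
rewrite (@tonelli_prod _ _ _ _ _ _ _ mu mu mu
   (fun w : (R * R) * R => F a w.1.1 w.2 * F b w.1.2 w.2)); last 2 first.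
- by apply: emeasurable_funM; apply: mF => //; exact: measurableT_comp.
- by move=> w; rewrite mule_ge0.
rewrite [RHS]integral_mkcond; apply: eq_integral => s _ /=.
rewrite (@integral_prod_mul _ _ _ _ _ mu mu (F a ^~ s) (F b ^~ s))//;
  last 2 first.
- exact: mF.
- exact: mF.
rewrite !F1// patchE mem_setE in_itv/= le_min; case: ifPn => s0/=; last by rewrite mul0e.
have [sb|sb] := leP s b; last by rewrite (KH_lt _ _ sb) mule0.
have [sa|sa] := leP s a; last by rewrite (KH_lt _ _ sa) mul0e.
by rewrite EFinM.
Qed.

Lemma integral_riesz_rect a b :
  \int[mu \x mu]_(z in `[0%R, a] `*` `[0%R, b]) riesz z =
  (H * (2 * H - 1))%:E * \int[mu]_(r in `[0%R, a]) \int[mu]_(u in `[0%R, b])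
    (`|u - r| `^ (2 * H - 2))%:E.
Proof.
have mab : measurable (`[0%R, a]%classic `*` `[0%R, b]%classic : set (R * R)).
  by apply: measurableX; exact: measurable_itv.
rewrite ge0_integralZl//; last 2 first.
- by apply: measurable_funTS; exact: measurable_norm_powR.
- by rewrite lee_fin ltW// riesz_cst_gt0.
by rewrite integral_setX//; exact: measurable_norm_powR.
Qed.

Hypothesis (T0 : (0 < T)%R).

(** The bound of [integral_norm_powR_le] on [0, T] for the exponent 2H - 2, uniform in the position
    of the singularity. *)
Definition riesz_bound : R := (2 * (T `^ (2 * H - 1) / (2 * H - 1)))%R.

Lemma integral_norm_powR_le_riesz_bound r : r \in `[0%R, T] ->
  \int[mu]_(s in `[0%R, T]) (`|s - r| `^ (2 * H - 2))%:E <= riesz_bound%:E.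
Proof.
have := H1; have := H12 => h12 h1 rT.
have a0 : (2 * H - 2 != 0)%R by apply/eqP => ?; lra.
have a1 : (-1 < 2 * H - 2)%R by lra.
have := integral_norm_powR_le a1 a0 rT.
by rewrite subr0 (_ : 2 * H - 2 + 1 = 2 * H - 1)%R; last ring.
Qed.

Lemma riesz_bound_ge0 : (0 <= riesz_bound)%R.
Proof.
by have := H12 => h12; rewrite mulr_ge0// divr_ge0 ?powR_ge0//; lra.
Qed.

Lemma integral_riesz_lty :
  \int[mu \x mu]_(z in `[0%R, T] `*` `[0%R, T]) riesz z < +oo.
Proof.
rewrite integral_riesz_rect.
rewrite lte_mul_pinfty ?lee_fin ?(ltW riesz_cst_gt0)//.
apply: (@le_lt_trans _ _ (\int[mu]_(r in `[0%R, T]) riesz_bound%:E)).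
  apply: ge0_le_integral => //.
  - by move=> r _; apply: integral_ge0 => s _; rewrite lee_fin powR_ge0.
  - apply: measurable_funTS.
    apply: (measurable_integral_param mu _ (measurable_norm_powR (2 * H - 2))) => //.
  - by move=> r rT; apply: integral_norm_powR_le_riesz_bound.
by rewrite integral_cst//= lebesgue_measure_itv/= lte_fin T0 -EFinB -EFinM ltry.
Qed.

Hypothesis hCH : KH_normalization CH H.

(** Cut off outside [0, T]^2, the two densities define measures that agree on quadrants, since a
    quadrant meets the square in the empty set or in a rectangle with corner 0. The measures then
    agree on all Borel sets, which forces the densities to agree almost everywhere. *)
Lemma dKH_cov_ae_riesz :
  ae_eq (mu \x mu) (`[0%R, T] `*` `[0%R, T]) riesz dKH_cov.
Proof.
set D := _ `*` _.
have mD : measurable (D : set (R * R)) by apply: measurableX; exact: measurable_itv.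
have mr := measurable_riesz; have mk := measurable_dKH_cov.
apply: integral_ae_eq => //.
- apply/integrableP; split; first exact: measurable_funTS.
  under eq_integral do rewrite gee0_abs ?riesz_ge0//.
  exact: integral_riesz_lty.
- exact: measurable_funTS.
pose r' := riesz \_ D; pose k' := dKH_cov \_ D.
have r'0 z : 0 <= r' z by apply: erestrict_ge0 => ? _; exact: riesz_ge0.
have k'0 z : 0 <= k' z by apply: erestrict_ge0 => ? _; exact: dKH_cov_ge0.
have mr' : measurable_fun setT r' by exact/(measurable_restrictT _ _).1/measurable_funTS.
have mk' : measurable_fun setT k' by exact/(measurable_restrictT _ _).1/measurable_funTS.
suff E A : measurable A ->
    density (mu \x mu) mr' r'0 A = density (mu \x mu) mk' k'0 A.
  move=> A AD mA; have := E A mA; rewrite /density /r' /k' -!integral_mkcondr.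
  by rewrite !setIidl.
have mrays x y : measurable (`]-oo, x]%classic `*` `]-oo, y]%classic : set (R * R)).
  by apply: measurableX; exact: measurable_itv.
have U := @measure_unique_plane_rays R (density (mu \x mu) mr' r'0)
  (density (mu \x mu) mk' k'0).
apply: U => [a b|a] /=; rewrite /density /r' /k'; last first.
  rewrite -integral_mkcondr; apply: le_lt_trans integral_riesz_lty.
  apply: ge0_subset_integral => //.
  - by apply: measurableI => //; exact: mrays.
  - exact: measurable_funTS.
  - by move=> z _; exact: riesz_ge0.
rewrite -!integral_mkcondr.
have [a0|a0] := ltP a 0%R.
  rewrite (_ : _ `&` _ = set0) ?integral_set0//.
  apply/seteqP; split => // -[u v] [[/= + _] [/= + _]]; rewrite !in_itv/= => ua /andP[u0 _].
  by move: a0; rewrite ltNge (le_trans u0).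
have [b0|b0] := ltP b 0%R.
  rewrite (_ : _ `&` _ = set0) ?integral_set0//.
  apply/seteqP; split => // -[u v] [[/= _ +] [/= _ +]]; rewrite !in_itv/= => ua /andP[u0 _].
  by move: b0; rewrite ltNge (le_trans u0).
have -> : `]-oo, a] `*` `]-oo, b] `&` D =
    `[0%R, Num.min a T] `*` `[0%R, Num.min b T].
  apply/seteqP; split => -[u v]; rewrite /D /= !in_itv/= !le_min.
    by move=> [[-> ->] [/andP[-> ->] /andP[-> ->]]].
  by move=> [/and3P[-> -> ->] /and3P[-> -> ->]].
rewrite integral_riesz_rect integral_dKH_cov_rect ?le_min ?a0 ?b0 ?ltW//.
by case: hCH => _ ->//; rewrite le_min ?a0 ?b0 ltW.
Qed.

End CovarianceIdentity.

(** * Isometry of the operator K* *)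

Section EnergyIdentity.
Local Open Scope ereal_scope.
Variable R : realType.
Local Notation mu := (@lebesgue_measure R).
Variables CH H T : R.
Hypotheses (CH0 : (0 < CH)%R) (H12 : (2^-1 < H)%R) (H1 : (H < 1)%R).
Hypotheses (T0 : (0 < T)%R) (hCH : KH_normalization CH H).
Implicit Types f g : R * R -> R.

(** Integrands are extended by 0 so that all integrals run over whole lines and Tonelli applies
    without tracking domains. *)
Definition vanishes_off f := forall z, ~ domainT T z -> f z = 0%R.

Local Notation c := (H * (2 * H - 1))%R.
Local Notation wt := (fun z : R * R => (`|z.2 - z.1| `^ (2 * H - 2))%:E).

(** Integrating out the space variable first leaves a function of the two times alone, under which
    the almost everywhere identity of densities can be substituted. *)
Definition cross f g (z : R * R) : \bar R :=
  \int[mu]_y (f (z.2, y) * g (z.1, y))%:E.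

Definition energy f g : \bar R := \int[mu \x mu]_z (cross f g z * wt z).

(* The operator K_H^* whose isometry property defines the Wiener integral; the
   argument w = (y, s) has the space variable first. *)
Definition Kstar f (w : R * R) : \bar R :=
  \int[mu]_u (f (u, w.1) * dKH CH H u w.2)%:E.

Section nonneg.
Variables f g : R * R -> R.
Hypotheses (mf : measurable_fun setT f) (mg : measurable_fun setT g).
Hypotheses (f0 : forall z, (0 <= f z)%R) (g0 : forall z, (0 <= g z)%R).

Lemma cross_ge0 z : 0 <= cross f g z.
Proof. by apply: integral_ge0 => y _; rewrite lee_fin mulr_ge0. Qed.

Lemma measurable_cross : measurable_fun setT (cross f g).
Proof.
apply: (measurable_integral_param mu measurableT
  (f := fun w : (R * R) * R => (f (w.1.2, w.2) * g (w.1.1, w.2))%:E)).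
  apply/measurable_EFinP; apply: measurable_funM;
    by apply: measurable_pair2 => //; exact: measurableT_comp.
by move=> w; rewrite lee_fin mulr_ge0.
Qed.

Lemma Kstar_ge0 w : 0 <= Kstar f w.
Proof. by apply: integral_ge0 => u _; rewrite lee_fin mulr_ge0// dKH_ge0. Qed.

Lemma measurable_Kstar : measurable_fun setT (Kstar f).
Proof.
apply: (measurable_integral_param mu measurableT
  (f := fun w : (R * R) * R => (f (w.2, w.1.1) * dKH CH H w.2 w.1.2)%:E)).
  apply/measurable_EFinP; apply: measurable_funM.
    by apply: measurable_pair2 => //; exact: measurableT_comp.
  by apply: measurable_dKH2 => //; exact: measurableT_comp.
by move=> w; rewrite lee_fin mulr_ge0// dKH_ge0.
Qed.

Lemma measurable_wt : measurable_fun setT wt.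
Proof. exact: measurable_norm_powR. Qed.

Lemma wt_ge0 z : 0 <= wt z.
Proof. by rewrite lee_fin powR_ge0. Qed.

End nonneg.

(** Both sides may be +oo. After the substitution of densities, the integrals over the pair of times
    and over (y, s) are exchanged; for fixed (y, s) the integrand is a product in the two times and
    splits into two values of [Kstar]. *)
Lemma energy_Kstar f g :
  measurable_fun setT f -> measurable_fun setT g ->
  (forall z, (0 <= f z)%R) -> (forall z, (0 <= g z)%R) ->
  vanishes_off f -> vanishes_off g ->
  c%:E * energy f g = \int[mu \x mu]_w (Kstar g w * Kstar f w).
Proof.
move=> mf mg f0 g0 vf vg.
have mc := measurable_cross mf mg f0 g0; have c0 := cross_ge0 f0 g0.
have mw := measurable_wt.
have mK : measurable_fun setT (dKH_cov CH H) by exact: measurable_dKH_cov.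
have cpos := riesz_cst_gt0 H12.
have mD : measurable (`[0%R, T]%classic `*` `[0%R, T]%classic : set (R * R)).
  by apply: measurableX; exact: measurable_itv.
(* The density identity is available on the square only, and outside it [cross] vanishes. *)
have cD z : ~ (`[0%R, T] `*` `[0%R, T])%classic z -> cross f g z = 0.
  move=> zD; apply: integral0_eq => y _.
  have [zT|zT] := pselect (`[0%R, T]%classic z.2).
    rewrite vg ?mulr0// => -[/= h _]; exact: zD.
  by rewrite vf ?mul0r// => -[].
rewrite -ge0_integralZl//; last 3 first.
- exact: emeasurable_funM.
- by move=> z _; rewrite mule_ge0// wt_ge0.
- by rewrite lee_fin ltW.
transitivity (\int[mu \x mu]_z (cross f g z * dKH_cov CH H z)).
  transitivity (\int[mu \x mu]_(z in `[0%R, T] `*` `[0%R, T]) (cross f g z * riesz H z)).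
    rewrite [RHS]integral_mkcond; apply: eq_integral => z _; rewrite patchE.
    case: ifPn => [_|/negP zD]; first by rewrite /riesz muleCA.
    by rewrite cD ?mul0e ?mule0// => h; apply: zD; rewrite inE.
  transitivity (\int[mu \x mu]_(z in `[0%R, T] `*` `[0%R, T]) (cross f g z * dKH_cov CH H z)).
    apply: ge0_ae_eq_integral => //.
    - apply: measurable_funTS; apply: emeasurable_funM => //.
      exact: measurable_riesz.
    - by apply: measurable_funTS; exact: emeasurable_funM.
    - by move=> z _; rewrite mule_ge0// riesz_ge0.
    - by move=> z _; rewrite mule_ge0// dKH_cov_ge0.
    - apply: filterS (dKH_cov_ae_riesz CH0 H12 H1 T0 hCH) => z h zD.
      by rewrite h.
  rewrite integral_mkcond; apply: eq_integral => z _; rewrite patchE.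
  case: ifPn => // /negP zD.
  by rewrite cD ?mul0e// => h; apply: zD; rewrite inE.
pose F (w : (R * R) * (R * R)) : \bar R := (f (w.1.2, w.2.1) * g (w.1.1, w.2.1))%:E *
   (dKH CH H w.1.1 w.2.2 * dKH CH H w.1.2 w.2.2)%:E.
have F0 w : 0 <= F w by rewrite mule_ge0// lee_fin mulr_ge0// dKH_ge0.
have mF : measurable_fun setT F.
  apply: emeasurable_funM; apply/measurable_EFinP; apply: measurable_funM;
    by [apply: measurable_pair2 => //; do 2! apply: measurableT_comp => //
       |apply: measurable_dKH2 => //; do 2! apply: measurableT_comp => //].
transitivity (\int[mu \x mu]_z \int[mu \x mu]_w F (z, w)).
  apply: eq_integral => z _.
  rewrite (@integral_prod_mul _ _ _ _ _ mu mu
     (fun y => (f (z.2, y) * g (z.1, y))%:E)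
     (fun s => (dKH CH H z.1 s * dKH CH H z.2 s)%:E))//.
  - by apply/measurable_EFinP; apply: measurable_funM; exact: measurable_pair2.
  - by apply/measurable_EFinP; apply: measurable_funM; exact: measurable_dKH2.
  - by move=> y; rewrite lee_fin mulr_ge0.
  - by move=> y; rewrite lee_fin mulr_ge0// dKH_ge0.
rewrite tonelli_prod_prod//; apply: eq_integral => w _.
rewrite /Kstar -(@integral_prod_mul _ _ _ _ _ mu mu
     (fun u => (g (u, w.1) * dKH CH H u w.2)%:E)
     (fun u => (f (u, w.1) * dKH CH H u w.2)%:E))//.
- apply: eq_integral => z _; rewrite /F/= -!EFinM; congr EFin; ring.
- apply/measurable_EFinP; apply: measurable_funM; first exact: measurable_pair2.
  exact: measurable_dKH2.
- apply/measurable_EFinP; apply: measurable_funM; first exact: measurable_pair2.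
  exact: measurable_dKH2.
- by move=> y; rewrite lee_fin mulr_ge0// dKH_ge0.
- by move=> y; rewrite lee_fin mulr_ge0// dKH_ge0.
Qed.

End EnergyIdentity.

(** * The isometry for signed integrands of finite energy *)

Section SignedEnergy.
Local Open Scope ereal_scope.
Variable R : realType.
Local Notation mu := (@lebesgue_measure R).
Variables CH H T : R.
Hypotheses (CH0 : (0 < CH)%R) (H12 : (2^-1 < H)%R) (H1 : (H < 1)%R).
Hypotheses (T0 : (0 < T)%R) (hCH : KH_normalization CH H).
Implicit Types f g : R * R -> R.

Local Notation c := (H * (2 * H - 1))%R.
Local Notation wt := (fun z : R * R => (`|z.2 - z.1| `^ (2 * H - 2))%:E).
Local Notation energy := (energy H).
Local Notation Kstar := (Kstar CH H).
Local Notation vanishes_off := (vanishes_off T).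

Lemma energy_ge0 f g : (forall z, (0 <= f z)%R) -> (forall z, (0 <= g z)%R) ->
  0 <= energy f g.
Proof.
by move=> f0 g0; apply: integral_ge0 => z _; rewrite mule_ge0 ?cross_ge0 ?wt_ge0.
Qed.

Lemma energy_le f f' g g' :
  measurable_fun setT f -> measurable_fun setT g ->
  measurable_fun setT f' -> measurable_fun setT g' ->
  (forall z, (0 <= f z <= f' z)%R) -> (forall z, (0 <= g z <= g' z)%R) ->
  energy f g <= energy f' g'.
Proof.
move=> mf mg mf' mg' ff gg.
have f0 z : (0 <= f z)%R by case/andP: (ff z).
have g0 z : (0 <= g z)%R by case/andP: (gg z).
have f'0 z : (0 <= f' z)%R by case/andP: (ff z) => /le_trans; apply.
have g'0 z : (0 <= g' z)%R by case/andP: (gg z) => /le_trans; apply.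
have mw := @measurable_wt R H; have mc := @measurable_cross R.
apply: ge0_le_integral => //.
- by move=> z _; rewrite mule_ge0// ?cross_ge0// lee_fin powR_ge0.
- by apply: emeasurable_funM => //; exact: mc.
- by apply: emeasurable_funM => //; exact: mc.
move=> z _; rewrite lee_wpmul2r ?lee_fin ?powR_ge0//.
have mp (h k : R * R -> R) : measurable_fun setT h -> measurable_fun setT k ->
   measurable_fun setT (fun y => (h (z.2, y) * k (z.1, y))%:E).
  move=> mh mk; apply/measurable_EFinP; apply: measurable_funM;
    exact: measurable_pair2.
apply: ge0_le_integral => //.
- by move=> y _; rewrite lee_fin mulr_ge0.
- exact: mp.
- exact: mp.
move=> y _; rewrite lee_fin ler_pM//.
  by case/andP: (ff (z.2, y)).
by case/andP: (gg (z.1, y)).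
Qed.

Lemma iterated_integral_vanishes (F : R -> R -> R -> R) :
  (forall r s y, ~ domainT T (s, y) \/ ~ domainT T (r, y) -> F r s y = 0%R) ->
  \int[mu]_(r in `[0%R, T]) \int[mu]_(s in `[0%R, T])
    \int[mu]_(y in `[0%R, 1%R]) (F r s y)%:E =
  \int[mu]_r \int[mu]_s \int[mu]_y (F r s y)%:E.
Proof.
move=> F0; rewrite integral_mkcond; apply: eq_integral => r _.
rewrite patchE; case: ifPn => [_|/negP rT]; last first.
  rewrite integral0_eq// => s _; rewrite integral0_eq// => y _.
  by rewrite F0//; right => -[/= h _]; apply: rT; rewrite inE.
rewrite integral_mkcond; apply: eq_integral => s _.
rewrite patchE; case: ifPn => [_|/negP rT]; last first.
  rewrite integral0_eq// => y _.
  by rewrite F0//; left => -[/= h _]; apply: rT; rewrite inE.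
rewrite integral_mkcond; apply: eq_integral => y _.
rewrite patchE; case: ifPn => [_//|/negP rT].
by rewrite F0//; left => -[/= _ h]; apply: rT; rewrite inE.
Qed.

Lemma energyE f g :
  measurable_fun setT f -> measurable_fun setT g ->
  (forall z, (0 <= f z)%R) -> (forall z, (0 <= g z)%R) ->
  vanishes_off f -> vanishes_off g ->
  \int[mu]_(r in `[0%R, T]) \int[mu]_(s in `[0%R, T])
    \int[mu]_(y in `[0%R, 1%R])
     (f (s, y) * `|s - r| `^ (2 * H - 2) * g (r, y))%:E = energy f g.
Proof.
move=> mf mg f0 g0 vf vg.
rewrite (@iterated_integral_vanishes
  (fun r s y => (f (s, y) * `|s - r| `^ (2 * H - 2) * g (r, y))%R)); last first.
  by move=> r s y [?|?]; [rewrite vf// !mul0r|rewrite vg// mulr0].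
rewrite /energy fubini_tonelli1.
- apply: eq_integral => r _; rewrite /fubini_F/=; apply: eq_integral => s _.
  have mfg : measurable_fun setT (fun y => (f (s, y) * g (r, y))%:E).
    apply/measurable_EFinP; apply: measurable_funM; exact: measurable_pair2.
  rewrite /cross -ge0_integralZr//=; last by move=> y _; rewrite lee_fin mulr_ge0.
  by apply: eq_integral => y _; rewrite mulrAC EFinM.
- apply: emeasurable_funM; [exact: measurable_cross|exact: measurable_wt].
- by move=> z; rewrite mule_ge0// ?cross_ge0// lee_fin powR_ge0.
Qed.

Lemma energyE_prod f g :
  energy f g = \int[mu \x mu]_z (cross f g z * wt z).
Proof. by []. Qed.

Section signed.
Variable phi : R * R -> R.
Hypotheses (mphi : measurable_fun setT phi) (vphi : vanishes_off phi).
Hypothesis fphi : energy (fun z => `|phi z|%R) (fun z => `|phi z|%R) < +oo.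
Local Notation p := (phi^\+)%R.
Local Notation n := (phi^\-)%R.

Let mp : measurable_fun setT p. Proof. exact: measurable_funrpos. Qed.
Let mn : measurable_fun setT n. Proof. exact: measurable_funrneg. Qed.
Let p0 z : (0 <= p z)%R. Proof. exact: funrpos_ge0. Qed.
Let n0 z : (0 <= n z)%R. Proof. exact: funrneg_ge0. Qed.
Let vp : vanishes_off p.
Proof. by move=> z /vphi h; rewrite /funrpos h maxxx. Qed.
Let vn : vanishes_off n.
Proof. by move=> z /vphi h; rewrite /funrneg h oppr0 maxxx. Qed.

Let elt f g : measurable_fun setT f -> measurable_fun setT g ->
  (forall z, (0 <= f z <= `|phi z|)%R) -> (forall z, (0 <= g z <= `|phi z|)%R) ->
  energy f g < +oo.
Proof.
move=> mf mg ff gg; apply: le_lt_trans fphi; apply: energy_le => //;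
  exact: measurableT_comp.
Qed.

Let ple z : (0 <= p z <= `|phi z|)%R.
Proof. by rewrite p0/= /funrpos ge_max ler_norm normr_ge0. Qed.
Let nle z : (0 <= n z <= `|phi z|)%R.
Proof. by rewrite n0/= /funrneg ge_max -normrN ler_norm normr_ge0. Qed.

Let Kp := Kstar p.
Let Kn := Kstar n.
Let mKp : measurable_fun setT Kp. Proof. exact: measurable_Kstar. Qed.
Let mKn : measurable_fun setT Kn. Proof. exact: measurable_Kstar. Qed.

Let integrable_KK f g : measurable_fun setT f -> measurable_fun setT g ->
  (forall z, (0 <= f z <= `|phi z|)%R) -> (forall z, (0 <= g z <= `|phi z|)%R) ->
  vanishes_off f -> vanishes_off g ->
  (mu \x mu).-integrable setT (fun w => Kstar g w * Kstar f w).
Proof.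
move=> mf mg ff gg vf vg.
have f0 z : (0 <= f z)%R by case/andP: (ff z).
have g0 z : (0 <= g z)%R by case/andP: (gg z).
apply/integrableP; split.
  by apply: emeasurable_funM; exact: measurable_Kstar.
under eq_integral do rewrite gee0_abs ?mule_ge0 ?Kstar_ge0//.
rewrite -(energy_Kstar CH0 H12 H1 T0 hCH mf mg f0 g0 vf vg).
apply: lte_mul_pinfty; [|by []|exact: elt].
by rewrite lee_fin; exact: ltW (riesz_cst_gt0 H12).
Qed.

(** The squares of both functions are integrable, and an integrable function is finite almost
    everywhere. *)
Lemma Kstar_fin_num :
  {ae mu \x mu, forall w, Kstar p w \is a fin_num /\ Kstar n w \is a fin_num}.
Proof.
have ip := integrable_KK mp mp ple ple vp vp.
have iN := integrable_KK mn mn nle nle vn vn.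
apply: filterS (filterI (integrable_ae measurableT ip)
  (integrable_ae measurableT iN)) => w [/(_ Logic.I) h1 /(_ Logic.I) h2].
have H3 (x : \bar R) : 0 <= x -> x * x \is a fin_num -> x \is a fin_num.
  by case: x => // _; rewrite mulyy.
split; apply: H3 => //; exact: Kstar_ge0.
Qed.

Lemma Kstar_sqr_lty :
  \int[mu \x mu]_w (Kstar p w * Kstar p w + Kstar n w * Kstar n w) < +oo.
Proof.
have ip := integrable_KK mp mp ple ple vp vp.
have iN := integrable_KK mn mn nle nle vn vn.
exact: (integrable_lty measurableT (integrableD measurableT ip iN)).
Qed.

(** The integral of a signed function is by definition the difference of the integrals of its two
    parts. The positive part of phi * w * phi is (p p + n n) w and the negative part is (p n + n p)
    w, so the identity holds at every z, even where the integral diverges. *)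
Let innerE z : \int[mu]_y (phi (z.2, y) * `|z.2 - z.1| `^ (2 * H - 2) * phi (z.1, y))%:E
  = (cross p p z + cross n n z) * wt z - (cross p n z + cross n p z) * wt z.
Proof.
pose w := (`|z.2 - z.1| `^ (2 * H - 2))%R; rewrite /= -/w.
have w0 : (0 <= w)%R by exact: powR_ge0.
have mcr f g : measurable_fun setT f -> measurable_fun setT g ->
    measurable_fun setT (fun y => (f (z.2, y) * g (z.1, y))%:E).
  move=> mf mg; apply/measurable_EFinP; apply: measurable_funM;
    exact: measurable_pair2.
have pos (a b : R) : Num.max (a * w * b)%R 0%R =
    ((Num.max a 0 * Num.max b 0 + Num.max (- a) 0 * Num.max (- b) 0) * w)%R.
  case/orP: (le_total 0%R a) => ha; case/orP: (le_total 0%R b) => hb.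
  - rewrite (max_l ha) (max_l hb) max_l ?mulr_ge0// !max_r ?oppr_le0//; ring.
  - rewrite (max_l ha) (max_r hb) [Num.max (- a)%R 0%R]max_r ?oppr_le0//.
    by rewrite mulr0 mul0r addr0 mul0r max_r// mulr_ge0_le0 ?mulr_ge0.
  - rewrite (max_l hb) (max_r ha) [Num.max (- b)%R 0%R]max_r ?oppr_le0//.
    by rewrite mulr0 mul0r addr0 mul0r max_r// mulr_le0_ge0 ?mulr_le0_ge0.
  - rewrite (max_r hb) (max_r ha) !max_l ?oppr_ge0//; first ring.
    by rewrite mulr_le0 ?mulr_le0_ge0.
rewrite integralE; congr (_ - _).
- rewrite /cross -ge0_integralD//=;
    try by [exact: mcr|move=> y _; rewrite lee_fin mulr_ge0].
  rewrite -ge0_integralZr//; try by [apply: emeasurable_funD; exact: mcr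
    |move=> y _; rewrite -EFinD lee_fin addr_ge0// mulr_ge0].
  apply: eq_integral => y _; rewrite funeposE -EFin_max -EFinD -EFinM.
  by rewrite pos.
- rewrite /cross -ge0_integralD//=;
    try by [exact: mcr|move=> y _; rewrite lee_fin mulr_ge0].
  rewrite -ge0_integralZr//; try by [apply: emeasurable_funD; exact: mcr
    |move=> y _; rewrite -EFinD lee_fin addr_ge0// mulr_ge0].
  apply: eq_integral => y _; rewrite funenegE -EFinN -EFin_max -EFinD -EFinM.
  by rewrite -!mulNr pos opprK [in RHS]addrC.
Qed.

Lemma HT_sqnorm_Kstar : HT_sqnorm H T phi =
  \int[mu \x mu]_w ((fine (Kstar p w) - fine (Kstar n w)) ^+ 2)%:E.
Proof.
have cpos := riesz_cst_gt0 H12.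
have mw := @measurable_wt R H; have mc := @measurable_cross R.
rewrite /HT_sqnorm /HT_inner.
rewrite (@iterated_integral_vanishes
  (fun r s y => (phi (s, y) * `|s - r| `^ (2 * H - 2) * phi (r, y))%R)); last first.
  by move=> r s y [/vphi ->|/vphi ->]; rewrite ?mul0r ?mulr0.
have iJ f g f' g' : measurable_fun setT f -> measurable_fun setT g ->
    measurable_fun setT f' -> measurable_fun setT g' ->
    (forall z, (0 <= f z <= `|phi z|)%R) -> (forall z, (0 <= g z <= `|phi z|)%R) ->
    (forall z, (0 <= f' z <= `|phi z|)%R) -> (forall z, (0 <= g' z <= `|phi z|)%R) ->
    (mu \x mu).-integrable setT (fun z => (cross f g z + cross f' g' z) * wt z) /\
    \int[mu \x mu]_z ((cross f g z + cross f' g' z) * wt z) =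
    energy f g + energy f' g'.
  move=> mf mg mf' mg' ff gg ff' gg'.
  have f0 z : (0 <= f z)%R by case/andP: (ff z).
  have g0 z : (0 <= g z)%R by case/andP: (gg z).
  have f'0 z : (0 <= f' z)%R by case/andP: (ff' z).
  have g'0 z : (0 <= g' z)%R by case/andP: (gg' z).
  have mA : measurable_fun setT (fun z => cross f g z * wt z).
    by apply: emeasurable_funM => //; exact: mc.
  have mA' : measurable_fun setT (fun z => cross f' g' z * wt z).
    by apply: emeasurable_funM => //; exact: mc.
  have A0 z : 0 <= cross f g z * wt z by rewrite mule_ge0 ?cross_ge0 ?wt_ge0.
  have A'0 z : 0 <= cross f' g' z * wt z by rewrite mule_ge0 ?cross_ge0 ?wt_ge0.
  have AE : \int[mu \x mu]_z ((cross f g z + cross f' g' z) * wt z) =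
    energy f g + energy f' g'.
    rewrite !energyE_prod -ge0_integralD//; apply: eq_integral => z _.
    by rewrite ge0_muleDl ?cross_ge0.
  split => //; apply/integrableP; split.
    apply: emeasurable_funM => //; apply: emeasurable_funD; exact: mc.
  have S0 z : 0 <= (cross f g z + cross f' g' z) * wt z.
    by apply: mule_ge0; [apply: adde_ge0; exact: cross_ge0|exact: (@wt_ge0 R H)].
  under eq_integral do rewrite (gee0_abs (S0 _)).
  rewrite AE; apply: lte_add_pinfty; exact: elt.
have [i1 e1] := iJ p p n n mp mp mn mn ple ple nle nle.
have [i2 e2] := iJ p n n p mp mn mn mp ple nle nle ple.
transitivity (c%:E * \int[mu]_r \int[mu]_s
   ((cross p p (r, s) + cross n n (r, s)) * wt (r, s) -
    (cross p n (r, s) + cross n p (r, s)) * wt (r, s))).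
  congr (_ * _); apply: eq_integral => r _; apply: eq_integral => s _.
  by rewrite -(innerE (r, s)).
(* The integrand is signed, so Fubini's theorem replaces Tonelli's; this is what the integrability
   in [iJ] is for. *)
have i12 := integrableB measurableT i1 i2.
rewrite (integral12_prod_meas1 i12) integralB// e1 e2.
have efin f g : measurable_fun setT f -> measurable_fun setT g ->
  (forall z, (0 <= f z <= `|phi z|)%R) -> (forall z, (0 <= g z <= `|phi z|)%R) ->
  energy f g \is a fin_num.
  move=> mf mg ff gg; rewrite ge0_fin_numE ?elt//.
  apply: integral_ge0 => z _; rewrite mule_ge0 ?wt_ge0// cross_ge0//.
    by move=> x; case/andP: (ff x).
  by move=> x; case/andP: (gg x).
have KE := energy_Kstar CH0 H12 H1 T0 hCH.
have ipp := integrable_KK mp mp ple ple vp vp.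
have inn := integrable_KK mn mn nle nle vn vn.
have ipn := integrable_KK mp mn ple nle vp vn.
have inp := integrable_KK mn mp nle ple vn vp.
have E1 : c%:E * (energy p p + energy n n) =
    \int[mu \x mu]_w (Kp w * Kp w + Kn w * Kn w).
  apply: etrans (esym (integralD measurableT ipp inn)).
  apply: etrans (ge0_muleDr _ (energy_ge0 p0 p0) (energy_ge0 n0 n0)) _.
  exact: (f_equal2 adde (KE _ _ mp mp p0 p0 vp vp) (KE _ _ mn mn n0 n0 vn vn)).
have E2 : c%:E * (energy p n + energy n p) =
    \int[mu \x mu]_w (Kn w * Kp w + Kp w * Kn w).
  apply: etrans (esym (integralD measurableT ipn inp)).
  apply: etrans (ge0_muleDr _ (energy_ge0 p0 n0) (energy_ge0 n0 p0)) _.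
  exact: (f_equal2 adde (KE _ _ mp mn p0 n0 vp vn) (KE _ _ mn mp n0 p0 vn vp)).
have fin12 : energy p n + energy n p \is a fin_num.
  by rewrite fin_numD; apply/andP; split; [exact: efin ple nle|exact: efin nle ple].
have cfin : c%:E \is a fin_num by [].
(* Multiplication by c distributes over a difference of extended reals only when that difference is
   not of the form +oo - +oo. *)
have fin12' : energy p p + energy n n +? - (energy p n + energy n p).
  by apply: fin_num_adde_defl; rewrite fin_numN.
apply: etrans (muleBr cfin fin12') _.
apply: etrans (f_equal2 (fun a b => a - b) E1 E2) _.
apply: etrans (esym (integralB measurableT (integrableD measurableT ipp inn)
  (integrableD measurableT ipn inp))) _.
apply: ae_eq_integral; first by [].
- apply: emeasurable_funB; apply: emeasurable_funD; exact: emeasurable_funM.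
- apply/measurable_EFinP; apply: measurable_funX; apply: measurable_funB;
    exact: measurableT_comp.
(* Off the null set where [Kp] or [Kn] is infinite, the integrand is the expansion of a real
   square. *)
have [N [mN N0 hN]] := Kstar_fin_num; exists N; split => // w wN.
apply: hN => -[hp hn]; apply: wN => _ /=; rewrite /Kp /Kn.
rewrite -[in LHS](fineK hp) -[in LHS](fineK hn).
by rewrite -!EFinM -!EFinD; congr EFin; ring.
Qed.

End signed.
End SignedEnergy.

(** * Finite energy of square integrable functions *)

Section EnergyL2.
Local Open Scope ereal_scope.
Variable R : realType.
Local Notation mu := (@lebesgue_measure R).
Variables H T : R.
Hypotheses (H12 : (2^-1 < H)%R) (H1 : (H < 1)%R) (T0 : (0 < T)%R).

Local Notation wt := (fun z : R * R => (`|z.2 - z.1| `^ (2 * H - 2))%:E).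

Lemma L2_sqnorm_vanishes (f : R * R -> R) : vanishes_off T f ->
  L2_sqnorm T f = \int[mu]_s \int[mu]_y (f (s, y) ^+ 2)%:E.
Proof.
move=> vf; rewrite /L2_sqnorm integral_mkcond; apply: eq_integral => s _.
rewrite patchE; case: ifPn => [_|/negP sT]; last first.
  rewrite integral0_eq// => y _; rewrite vf ?expr0n// => -[/= h _].
  by apply: sT; rewrite inE.
rewrite integral_mkcond; apply: eq_integral => y _.
rewrite patchE; case: ifPn => [//|/negP yT].
by rewrite vf ?expr0n// => -[/= _ h]; apply: yT; rewrite inE.
Qed.

(** The inequality ab <= a^2 + b^2 separates the two times; each resulting term is [h] at one time
    against a marginal of the kernel, which [riesz_bound] controls. *)
Lemma energy_lty (f : R * R -> R) : measurable_fun setT f ->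
  (forall z, (0 <= f z)%R) -> vanishes_off T f ->
  L2_sqnorm T f < +oo -> energy H f f < +oo.
Proof.
move=> mf f0 vf; rewrite L2_sqnorm_vanishes//.
set D := (`[0%R, T]%classic `*` `[0%R, T]%classic : set (R * R)).
have mD : measurable D by apply: measurableX; exact: measurable_itv.
pose h s := \int[mu]_y (f (s, y) ^+ 2)%:E.
rewrite -[X in X < _ -> _]/(\int[mu]_s h s) => hfin.
have msq : measurable_fun setT (fun z => (f z ^+ 2)%:E).
  by apply/measurable_EFinP; exact: measurable_funX.
have sq0 z : 0 <= (f z ^+ 2)%:E by rewrite lee_fin sqr_ge0.
have h0 s : 0 <= h s by apply: integral_ge0 => y _; exact: (sq0 (s, y)).
have mh : measurable_fun setT h.
  exact: (measurable_integral_param mu measurableT msq sq0).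
(* The truncation matters: over the whole line the marginals of the kernel are infinite. *)
pose kk := wt \_ D.
have kk0 z : 0 <= kk z by apply: erestrict_ge0 => ? _; rewrite lee_fin powR_ge0.
have mkk : measurable_fun setT kk.
  by apply/(measurable_restrictT _ mD); apply: measurable_funTS; exact: measurable_norm_powR.
have kkC r s : kk (r, s) = kk (s, r).
  by rewrite /kk !patchE /D !in_setX/= distrC andbC.
have kkK r : \int[mu]_s kk (r, s) <= (riesz_bound H T)%:E.
  have [rT|rT] := boolP (r \in `[0%R, T]); last first.
    rewrite integral0_eq ?lee_fin ?riesz_bound_ge0// => s _.
    by rewrite /kk patchE in_setX/= mem_setE (negbTE rT).
  apply: le_trans (integral_norm_powR_le_riesz_bound H12 H1 rT).
  rewrite [leRHS]integral_mkcond le_eqVlt; apply/orP; left; apply/eqP.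
  by apply: eq_integral => s _; rewrite /kk !patchE in_setX/= mem_setE rT.
have hy s : measurable_fun setT (fun y => (f (s, y) ^+ 2)%:E).
  by apply/measurable_EFinP; apply: measurable_funX; exact: measurable_pair2.
have crossle z : cross f f z <= h z.2 + h z.1.
  rewrite /h -ge0_integralD//; last 2 first.
  - exact: hy.
  - exact: hy.
  apply: ge0_le_integral => //.
  - by move=> y _; rewrite lee_fin mulr_ge0.
  - by apply/measurable_EFinP; apply: measurable_funM; exact: measurable_pair2.
  - by apply: emeasurable_funD; exact: hy.
  move=> y _; rewrite -EFinD lee_fin.
  have := f0 (z.2, y); have := f0 (z.1, y).
  by move: (f _) (f _) => a b b0 a0; nra.
have B1 : \int[mu \x mu]_z (h z.1 * kk z) < +oo.
  rewrite fubini_tonelli1; last 2 first.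
  - apply: emeasurable_funM => //; exact: (measurableT_comp mh measurable_fst).
  - by move=> z; rewrite mule_ge0.
  apply: (@le_lt_trans _ _ (\int[mu]_r (h r * (riesz_bound H T)%:E))).
    apply: ge0_le_integral => //.
    - by move=> r _; apply: integral_ge0 => s _; rewrite mule_ge0.
    - apply: measurable_fun_fubini_tonelli_F.
        by apply: emeasurable_funM => //; exact: (measurableT_comp mh measurable_fst).
      by move=> z; rewrite mule_ge0.
    - exact: emeasurable_funM.
    move=> r _; rewrite /fubini_F/= ge0_integralZl//.
    - exact: lee_wpmul2l.
    - by apply: (measurableT_comp mkk); exact: measurable_fun_pair.
  rewrite ge0_integralZr//; last by rewrite lee_fin riesz_bound_ge0.
  by rewrite muleC lte_mul_pinfty// lee_fin riesz_bound_ge0.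
have B2 : \int[mu \x mu]_z (h z.2 * kk z) < +oo.
  rewrite fubini_tonelli2; last 2 first.
  - apply: emeasurable_funM => //; exact: (measurableT_comp mh measurable_snd).
  - by move=> z; rewrite mule_ge0.
  apply: (@le_lt_trans _ _ (\int[mu]_r (h r * (riesz_bound H T)%:E))).
    apply: ge0_le_integral => //.
    - by move=> r _; apply: integral_ge0 => s _; rewrite mule_ge0.
    - apply: measurable_fun_fubini_tonelli_G.
        by apply: emeasurable_funM => //; exact: (measurableT_comp mh measurable_snd).
      by move=> z; rewrite mule_ge0.
    - exact: emeasurable_funM.
    move=> r _; rewrite /fubini_G/= ge0_integralZl//.
    - apply: lee_wpmul2l => //.
      by under eq_integral do rewrite kkC.
    - by apply: (measurableT_comp mkk); exact: measurable_fun_pair.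
  rewrite ge0_integralZr//; last by rewrite lee_fin riesz_bound_ge0.
  by rewrite muleC lte_mul_pinfty// lee_fin riesz_bound_ge0.
have mh1 : measurable_fun setT (fun z : R * R => h z.1 * kk z).
  apply: emeasurable_funM => //; exact: (measurableT_comp mh measurable_fst).
have mh2 : measurable_fun setT (fun z : R * R => h z.2 * kk z).
  apply: emeasurable_funM => //; exact: (measurableT_comp mh measurable_snd).
apply: (@le_lt_trans _ _ (\int[mu \x mu]_z (h z.2 * kk z + h z.1 * kk z))); last first.
  have p1 (z : R * R) : setT z -> 0 <= h z.1 * kk z by move=> _; exact: mule_ge0.
  have p2 (z : R * R) : setT z -> 0 <= h z.2 * kk z by move=> _; exact: mule_ge0.
  rewrite [X in X < _](ge0_integralD (mu \x mu) measurableT p2 mh2 p1 mh1).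
  exact: (lte_add_pinfty B2 B1).
apply: ge0_le_integral => //.
- by move=> z _; rewrite mule_ge0 ?cross_ge0// lee_fin powR_ge0.
- by apply: emeasurable_funM; [exact: measurable_cross|exact: measurable_wt].
- exact: emeasurable_funD.
move=> z _; rewrite -ge0_muleDl// /kk patchE; case: ifPn => [_|/negP zD].
  by rewrite lee_wpmul2r// lee_fin powR_ge0.
rewrite mule0 (_ : cross f f z = 0) ?mul0e//.
apply: integral0_eq => y _.
have [zT|zT] := pselect (`[0%R, T]%classic z.2).
  rewrite [f (z.1, y)]vf ?mulr0// => -[/= hh _]; apply: zD; rewrite inE; split => //.
by rewrite [f (z.2, y)]vf ?mul0r// => -[].
Qed.

End EnergyL2.

(** * The Dirichlet heat kernel *)

Section HeatKernel.
Variable R : realType.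
Implicit Types (a x y T : R) (n : int) (k : nat).

(** Amounts to q ln w <= w, which follows from ln w <= w when ln w >= 0 and from signs otherwise. *)
Lemma expRN_le_powR (w q : R) : 0 < w -> 0 <= q <= 1 -> expR (- w) <= w `^ (- q).
Proof.
move=> w0 /andP[q0 q1]; rewrite expRN powRN lef_pV2 ?posrE ?expR_gt0 ?powR_gt0//.
rewrite /powR gt_eqF// ler_expR.
have [l0|l0] := leP 0 (ln w).
  by rewrite (le_trans (ler_piMl l0 q1))// ltW// ln_sublinear.
by rewrite (@le_trans _ _ 0)// ?(ltW w0)// mulr_ge0_le0// ltW.
Qed.

Lemma series_geometric_bound (u : nat -> R) (A r : R) : 0 <= A -> 0 < r -> r < 1 ->
  (forall k, `|u k| <= A * r ^+ k) ->
  cvgn (series u) /\ `|limn (series u)| <= A / (1 - r).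
Proof.
move=> A0 r0 r1 ur.
have r1' : `|r| < 1 by rewrite gtr0_norm.
have cg := is_cvg_geometric_series (a := A) r1'.
have cn : cvgn [normed series u].
  apply: series_le_cvg cg => // k; first by rewrite /= normr_ge0.
  by rewrite /= mulr_ge0// exprn_ge0// ltW.
split; first exact: normed_cvg.
apply: le_trans (lim_series_norm cn) _.
rewrite -(cvg_lim _ (cvg_geometric_series (a := A) r1'))//.
exact: lim_series_le.
Qed.

(** Method of images: the displacement from the n-th image of the source to y. The image is x + 2n
    for [true] and the reflected point -x + 2n for [false]. *)
Definition image_dist (e : bool) x y n : R :=
  if e then y - x - 2 * n%:~R else y + x - 2 * n%:~R.

(** Lets every term of the series inherit the Gaussian factor of the direct term y - x. *)
Lemma image_dist_ge e x y n : 0 <= x <= 1 -> 0 <= y <= 1 ->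
  (y - x) ^+ 2 <= image_dist e x y n ^+ 2.
Proof.
move=> /andP[x0 x1] /andP[y0 y1].
have [n0|n0] := leP n 0.
  have h : (n%:~R : R) <= 0 by rewrite -[0]/(0%:~R) ler_int.
  have h' : n%:~R <= -1 :> R \/ n%:~R = 0 :> R.
    have [->|nn] := eqVneq n 0; [by right|left].
    by rewrite -[-1]/((-1)%:~R) ler_int; lia.
  case: e; rewrite /image_dist.
    case: h' => [h'|->]; last by rewrite mulr0 subr0.
    by move: (n%:~R) h h' => z h h'; nra.
  by move: (n%:~R) h h' => z h h'; nra.
have h : 1 <= (n%:~R : R) by rewrite -[1]/(1%:~R) ler_int; lia.
by case: e; rewrite /image_dist; move: (n%:~R) h => z h; nra.
Qed.

(** Growth linear in k is enough for geometric decay of the exponentials, and w^2 >= 2|w| - 1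
    provides it. The 5 is dictated by the image -x + 2k, for which this gives 4k - 2(x + y) - 1 >=
    4k - 5. *)
Lemma image_dist_linear e x y n k : 0 <= x <= 1 -> 0 <= y <= 1 ->
  n = Posz k \/ n = Negz k -> k%:R - 5 <= image_dist e x y n ^+ 2.
Proof.
move=> /andP[x0 x1] /andP[y0 y1] nk.
have k0 : (0 : R) <= k%:R by [].
have h : n%:~R = k%:R :> R \/ n%:~R = - (k%:R + 1) :> R.
  case: nk => ->; [by left|right].
  by rewrite NegzE rmorphN /= -pmulrn -natr1.
have sq1 (w : R) : 2 * w - 1 <= w ^+ 2.
  by have := sqr_ge0 (w - 1); rewrite sqrrB expr1n; lra.
have sq2 (w : R) : - (2 * w) - 1 <= w ^+ 2.
  by have := sqr_ge0 (w + 1); rewrite sqrrD expr1n; lra.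
case: e; rewrite /image_dist; case: h => ->; move: (k%:R) k0 => z z0.
- by apply: le_trans (sq2 _); lra.
- by apply: le_trans (sq1 _); lra.
- by apply: le_trans (sq2 _); lra.
- by apply: le_trans (sq1 _); lra.
Qed.

(* Half of the exponent keeps the singularity at y = x, the other half gives
   geometric decay in k. *)
Lemma heat_term_le e x y n k a T : 0 < a -> a <= T -> 0 <= x <= 1 -> 0 <= y <= 1 ->
  n = Posz k \/ n = Negz k ->
  expR (- image_dist e x y n ^+ 2 / (4 * a)) <=
  expR (- ((y - x) ^+ 2 / (8 * a))) * expR (5 / (8 * T)) * expR (- (8 * T)^-1) ^+ k.
Proof.
move=> a0 aT x01 y01 nk.
have T0 : 0 < T by apply: lt_le_trans aT.
rewrite -expRM_natl -!expRD ler_expR.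
have h1 := image_dist_ge e n x01 y01; have h2 := image_dist_linear e x01 y01 nk.
have d0 : 0 <= (y - x) ^+ 2 by exact: sqr_ge0.
move: (image_dist _ _ _ _ ^+ 2) ((y - x) ^+ 2) d0 h1 h2 => z d d0 h1 h2.
rewrite (_ : - z / (4 * a) = - (z / (8 * a)) - z / (8 * a)); last by field; lra.
rewrite -addrA lerD//.
  by rewrite lerN2 ler_pM2r// invr_gt0; lra.
rewrite (_ : _ + _ = - ((k%:R - 5) / (8 * T))); last by field; lra.
rewrite lerN2.
have z0 : 0 <= z by apply: le_trans h1; exact: d0.
have a80 : 0 < (8 * a)^-1 by rewrite invr_gt0; lra.
have T80 : 0 < (8 * T)^-1 by rewrite invr_gt0; lra.
have aT8 : (8 * T)^-1 <= (8 * a)^-1 by rewrite lef_pV2 ?posrE; lra.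
(* Replacing 1/(8a) by the smaller 1/(8T) goes in the right direction only when k - 5 is
   nonnegative; otherwise the signs of the two sides suffice. *)
have [k5|k5] := leP (k%:R) (5 : R).
  rewrite (@le_trans _ _ 0)//; last by rewrite mulr_ge0// ltW.
  by rewrite mulr_le0_ge0 ?subr_le0// ltW.
by rewrite ler_pM// ?subr_ge0 ltW.
Qed.

End HeatKernel.

(** * Square integrability of the heat kernel *)

Section HeatKernelL2.
Variable R : realType.
Local Notation mu := (@lebesgue_measure R).
Implicit Types (a x y T s t : R) (n : int) (k : nat).

Definition heat_summand a x y n : R :=
  expR (- (y - x - 2 * n%:~R) ^+ 2 / (4 * a)) -
  expR (- (y + x - 2 * n%:~R) ^+ 2 / (4 * a)).

Lemma heat_summand_le a x y T n k : 0 < a -> a <= T -> 0 <= x <= 1 -> 0 <= y <= 1 ->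
  n = Posz k \/ n = Negz k ->
  `|heat_summand a x y n| <=
  expR (- ((y - x) ^+ 2 / (8 * a))) * expR (5 / (8 * T)) * expR (- (8 * T)^-1) ^+ k.
Proof.
move=> a0 aT x01 y01 nk.
have h1 := heat_term_le true a0 aT x01 y01 nk.
have h2 := heat_term_le false a0 aT x01 y01 nk.
have e1 := expR_ge0 (- image_dist true x y n ^+ 2 / (4 * a)).
have e2 := expR_ge0 (- image_dist false x y n ^+ 2 / (4 * a)).
rewrite /heat_summand ler_norml; apply/andP; split.
  by rewrite lerBrDr (le_trans _ e1)// addrC subr_le0.
by rewrite lerBlDr (le_trans h1)// lerDl.
Qed.

Definition heat_ratio T := expR (- (8 * T)^-1).

Lemma heat_ratio_lt1 T : 0 < T -> heat_ratio T < 1.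
Proof. by move=> T0; rewrite expR_lt1 oppr_lt0 invr_gt0 mulr_gt0. Qed.

Lemma heat_series_bound a x y T : 0 < a -> a <= T -> 0 <= x <= 1 -> 0 <= y <= 1 ->
  [/\ cvgn (series (fun k => heat_summand a x y (Posz k))),
      cvgn (series (fun k => heat_summand a x y (Negz k))) &
      `|bilateral_sum (heat_summand a x y)| <=
        2 * (expR (5 / (8 * T)) / (1 - heat_ratio T)) *
          expR (- ((y - x) ^+ 2 / (8 * a)))].
Proof.
move=> a0 aT x01 y01; have T0 := lt_le_trans a0 aT.
set A := expR (- ((y - x) ^+ 2 / (8 * a))) * expR (5 / (8 * T)).
have A0 : 0 <= A by rewrite mulr_ge0 ?expR_ge0.
have r0 : 0 < heat_ratio T by exact: expR_gt0.
have [c1 b1] := series_geometric_bound A0 r0 (heat_ratio_lt1 T0)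
  (fun k => heat_summand_le a0 aT x01 y01 (or_introl (erefl (Posz k)))).
have [c2 b2] := series_geometric_bound A0 r0 (heat_ratio_lt1 T0)
  (fun k => heat_summand_le a0 aT x01 y01 (or_intror (erefl (Negz k)))).
split => //; rewrite /bilateral_sum (le_trans (ler_normD _ _))//.
rewrite (le_trans (lerD b1 b2))// /A le_eqVlt; apply/orP; left; apply/eqP.
by ring.
Qed.

(** The squared bound of the series, times 1/pi from the squared prefactor 1/(4 pi a), times the
    power of 4 left by (4a)^(-1) (4a)^(1/4). *)
Definition heat_bound_cst T : R :=
  (2 * (expR (5 / (8 * T)) / (1 - heat_ratio T))) ^+ 2 * pi^-1 * 4 `^ (- (3 / 4)).

(** The square is at most a constant times a^(-1) exp(-(y-x)^2/(4a)). Bounding the exponential by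
    the power -q of its argument gives a^(q-1) |y-x|^(-2q), integrable in time and in space
    separately for 0 < q < 1/2; here q = 1/4. *)
Lemma heat_kernel_sqr_le a x y T : 0 < a -> a <= T -> 0 <= x <= 1 -> 0 <= y <= 1 ->
  y != x ->
  heat_kernel a x y ^+ 2 <=
  heat_bound_cst T * (a `^ (- (3 / 4)) * `|y - x| `^ (- 2^-1)).
Proof.
move=> a0 aT x01 y01 yx.
have [_ _] := heat_series_bound a0 aT x01 y01.
set B := 2 * _; set S := bilateral_sum _ => SB.
have pi0 := pi_gt0 R.
have d0 : 0 < `|y - x| by rewrite normr_gt0 subr_eq0.
rewrite /heat_kernel -/S exprMn exprVn sqr_sqrtr; last by rewrite !mulr_ge0// ltW.
have B0 : 0 <= B.
  rewrite mulr_ge0// divr_ge0 ?expR_ge0// subr_ge0 ltW// heat_ratio_lt1//.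
  exact: lt_le_trans aT.
have S2 : S ^+ 2 <= B ^+ 2 * expR (- ((y - x) ^+ 2 / (4 * a))).
  rewrite -[S ^+ 2]real_normK ?num_real//.
  rewrite (_ : expR _ = expR (- ((y - x) ^+ 2 / (8 * a))) ^+ 2); last first.
    by rewrite -expRM_natl; congr expR; field; lra.
  by rewrite -exprMn lerXn2r// ?nnegrE// mulr_ge0// expR_ge0.
have E4 : expR (- ((y - x) ^+ 2 / (4 * a))) <= `|y - x| `^ (- 2^-1) * (4 * a) `^ 4^-1.
  have w0 : 0 < (y - x) ^+ 2 / (4 * a).
    by apply: divr_gt0; [rewrite exprn_even_gt0// subr_eq0|exact: mulr_gt0].
  have q01 : 0 <= (4^-1 : R) <= 1 by apply/andP; split; lra.
  apply: le_trans (expRN_le_powR w0 q01) _.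
  rewrite -[(y - x) ^+ 2]real_normK ?num_real// powRM; last 2 first.
  - exact: sqr_ge0.
  - by rewrite invr_ge0 mulr_ge0// ltW.
  rewrite -powR_mulrn// -powRrM -[(4 * a)^-1]powR_inv1; last by rewrite mulr_ge0// ltW.
  rewrite -powRrM (_ : 2 * - 4^-1 = - 2^-1 :> R); last by lra.
  by rewrite (_ : -1 * - 4^-1 = 4^-1 :> R)//; lra.
apply: (@le_trans _ _ ((4 * pi * a)^-1 *
  (B ^+ 2 * (`|y - x| `^ (- 2^-1) * (4 * a) `^ 4^-1)))).
  rewrite ler_wpM2l ?invr_ge0 ?mulr_ge0 ?(ltW pi0) ?(ltW a0)//.
  by rewrite (le_trans S2)// ler_wpM2l// sqr_ge0.
have h4 : (4 * a)^-1 * (4 * a) `^ 4^-1 = 4 `^ (- (3 / 4)) * a `^ (- (3 / 4)).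
  have a40 : 0 <= 4 * a by rewrite mulr_ge0// ltW.
  rewrite -powRM ?(ltW a0)// -[(4 * a)^-1]powR_inv1// -powRD.
    by congr (_ `^ _); lra.
  by apply/implyP => _; rewrite mulf_neq0 ?gt_eqF.
rewrite /heat_bound_cst -/B le_eqVlt; apply/orP; left; apply/eqP.
have -> : (4 * pi * a)^-1 = pi^-1 * (4 * a)^-1 :> R by rewrite mulrAC mulrC invfM.
move: h4; move: (pi^-1) ((4 * a)^-1) (`|y - x| `^ _) ((4 * a) `^ _) (4 `^ _) (a `^ _).
move=> p a4 d a4' u v h4.
have -> : p * a4 * (B ^+ 2 * (d * a4')) = B ^+ 2 * p * d * (a4 * a4') by ring.
by rewrite h4; ring.
Qed.

Lemma heat_kernel0 x y : heat_kernel 0 x y = 0.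
Proof. by rewrite /heat_kernel mulr0 sqrtr0 invr0 mul0r. Qed.

Section fixed.
Variables t x : R.
Hypotheses (t0 : 0 <= t) (x01 : 0 <= x <= 1).

Definition heat_slice (z : R * R) : R :=
  \1_(`[0, t] `*` `[0, 1]) z * heat_kernel (t - z.1) x z.2.

Lemma measurable_heat_slice : measurable_fun setT heat_slice.
Proof.
pose D : set (R * R) := `[0, t[%classic `*` `[0, 1]%classic.
have mD : measurable D by apply: measurableX; exact: measurable_itv.
pose f (z : R * R) := heat_kernel (t - z.1) x z.2.
have -> : heat_slice = f \_ D.
  apply/funext => -[s y]; rewrite /heat_slice patchE indicE /= !in_setX/=.
  rewrite !mem_setE !in_itv/=.
  have [s0|s0] := leP 0 s; last by rewrite mul0r.
  have [st|st|->] := ltgtP s t; rewrite ?mul0r//=.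
    by case: ifP; rewrite ?mul1r ?mul0r.
  by rewrite subrr heat_kernel0 mulr0.
apply/(measurable_restrictT _ mD).
have ma : measurable_fun D (fun z : R * R => t - z.1).
  by apply: measurable_funTS; exact: measurable_funB.
have apos z : D z -> 0 < t - z.1.
  by move=> [/= + _]; rewrite in_itv/= subr_gt0 => /andP[].
(* On [D] the inverse and the inverse square root are real powers, whose measurability is known. *)
have minv : measurable_fun D (fun z : R * R => (4 * (t - z.1))^-1).
  apply: (eq_measurable_fun (fun z : R * R => (4 * (t - z.1)) `^ (- 1))).
    by move=> z; rewrite inE => /apos a0; rewrite powR_inv1// mulr_ge0// ltW.
  by apply: (measurableT_comp (measurable_powR _)); exact: measurable_funM.
have msq : measurable_fun D (fun z : R * R => (Num.sqrt (4 * pi * (t - z.1)))^-1).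
  apply: (eq_measurable_fun (fun z : R * R => (4 * pi * (t - z.1)) `^ (- 2^-1))).
    move=> z; rewrite inE => /apos a0; rewrite powRN powR12_sqrt//.
    by rewrite mulr_ge0 ?mulr_ge0 ?pi_ge0// ltW.
  by apply: (measurableT_comp (measurable_powR _)); exact: measurable_funM.
have mhs n : measurable_fun D (fun z : R * R => heat_summand (t - z.1) x z.2 n).
  have m2 : measurable_fun D (fun z : R * R => z.2).
    by apply: measurable_funTS; exact: measurable_snd.
  apply: measurable_funB; apply: measurableT_comp => //; apply: measurable_funM => //;
    apply: measurableT_comp => //; apply: measurable_funX; apply: measurable_funB => //.
    exact: measurable_funB.
  exact: measurable_funD.
have m1 : measurable_fun D (fun z : R * R =>
    limn (series (fun k => heat_summand (t - z.1) x z.2 (Posz k)))).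
  apply: (@measurable_fun_cvg _ _ _ _ (fun N (z : R * R) =>
    series (fun k => heat_summand (t - z.1) x z.2 (Posz k)) N)).
    by move=> N; rewrite /series/=; apply: measurable_sum => k.
  move=> z Dz; have a0 := apos z Dz; case: Dz => _ /=; rewrite in_itv/= => y01.
  by have [c _ _] := heat_series_bound a0 (lexx _) x01 y01.
have m2 : measurable_fun D (fun z : R * R =>
    limn (series (fun k => heat_summand (t - z.1) x z.2 (Negz k)))).
  apply: (@measurable_fun_cvg _ _ _ _ (fun N (z : R * R) =>
    series (fun k => heat_summand (t - z.1) x z.2 (Negz k)) N)).
    by move=> N; rewrite /series/=; apply: measurable_sum => k.
  move=> z Dz; have a0 := apos z Dz; case: Dz => _ /=; rewrite in_itv/= => y01.
  by have [_ c _] := heat_series_bound a0 (lexx _) x01 y01.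
exact: (measurable_funM msq (measurable_funD m1 m2)).
Qed.

Lemma heat_slice_L2 T : t <= T -> (L2_sqnorm T heat_slice < +oo)%E.
Proof.
move=> tT; rewrite /L2_sqnorm; move: x01 => /andP[x0 x1].
have [a1 a1' b1 b1'] : [/\ -1 < - (3 / 4) :> R, - (3 / 4) != 0 :> R,
    -1 < - 2^-1 :> R & - 2^-1 != 0 :> R].
  by split; [lra|apply/eqP => ?; lra|lra|apply/eqP => ?; lra].
have xin : x \in `[0, 1] by rewrite in_itv/= x0 x1.
have tin : t \in `[0, T] by rewrite in_itv/= t0 tT.
have T0 := le_trans t0 tT.
have Iy := integral_norm_powR_le b1 b1' xin.
have It := integral_norm_powR_le a1 a1' tin.
move: Iy It; set Ky := 2 * _; set Kt := 2 * _ => Iy It.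
have Ky0 : 0 <= Ky by rewrite mulr_ge0// divr_ge0 ?powR_ge0//; lra.
have C0 : 0 <= heat_bound_cst t.
  apply: mulr_ge0; last exact: powR_ge0.
  by apply: mulr_ge0; [exact: sqr_ge0|rewrite invr_ge0 pi_ge0].
have mpow (a c : R) : measurable_fun setT (fun u : R => (`|u - c| `^ a)%:E).
  apply/measurable_EFinP; apply: (measurableT_comp (measurable_powR _)).
  by apply: measurableT_comp => //; exact: measurable_funB.
have mcpow (k a c : R) : measurable_fun setT (fun u : R => k%:E * (`|u - c| `^ a)%:E)%E.
  by apply: emeasurable_funM => //; exact: mpow.
have ms := measurable_heat_slice.
have ms2 : measurable_fun setT (fun z => (heat_slice z ^+ 2)%:E).
  by apply/measurable_EFinP; exact: measurable_funX.
have ms2y s : measurable_fun setT (fun y => (heat_slice (s, y) ^+ 2)%:E).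
  apply/measurable_EFinP; apply: measurable_funX.
  exact: measurable_pair2.
have mD1 : measurable (`[0%R, 1%R] `\ x : set R).
  by apply: measurableD; [exact: measurable_itv|exact: measurable_set1].
have bs s : 0 <= s -> (\int[mu]_(y in `[0%R, 1%R]) (heat_slice (s, y) ^+ 2)%:E <=
    (heat_bound_cst t * `|s - t| `^ (- (3 / 4)))%:E * Ky%:E)%E.
  move=> s0; have [st|st] := ltP s t; last first.
    rewrite integral0_eq.
      by apply: mule_ge0; rewrite lee_fin// mulr_ge0// powR_ge0.
    move=> y _; rewrite /heat_slice indicE in_setX/= mem_setE in_itv/= s0/=.
    move: st; rewrite [t <= s]le_eqVlt => /predU1P[<-|ts].
      by rewrite subrr heat_kernel0 mulr0 expr0n.
    by rewrite [s <= t]leNgt ts mul0r expr0n.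
  apply: (@le_trans _ _ (\int[mu]_(y in `[0%R, 1%R])
     ((heat_bound_cst t * `|s - t| `^ (- (3 / 4)))%:E * (`|y - x| `^ (- 2^-1))%:E))%E).
    (* The pointwise bound excludes y = x, where the power of 0 on its right-hand side is 0; this
       point is removed from both integrals. *)
    rewrite -(@integral_setD1 _ _ x); last 2 first.
    - exact: mD1.
    - exact: measurable_funTS.
    rewrite -[leRHS](@integral_setD1 _ _ x); last 2 first.
    - exact: mD1.
    - exact: (measurable_funTS (mcpow _ _ _)).
    apply: ge0_le_integral.
    - exact: mD1.
    - by move=> y _; rewrite lee_fin sqr_ge0.
    - exact: (measurable_funTS (ms2y s)).
    - exact: (measurable_funTS (mcpow _ _ _)).
    move=> y [/=]; rewrite in_itv/= => y01 /eqP yx.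
    rewrite -EFinM lee_fin /heat_slice indicE in_setX/= !mem_setE !in_itv/= s0 y01 (ltW st)/= mul1r.
    have ts0 : 0 < t - s by rewrite subr_gt0.
    have tst : t - s <= t by rewrite lerBlDr lerDl.
    have x01' : 0 <= x <= 1 by rewrite x0 x1.
    apply: le_trans (heat_kernel_sqr_le ts0 tst x01' y01 yx) _.
    rewrite [`|s - t|]distrC (gtr0_norm ts0).
    by rewrite mulrA.
  rewrite ge0_integralZl; [|exact: measurable_itv|exact: (measurable_funTS (mpow _ _))
    |by move=> y _; rewrite lee_fin powR_ge0|by rewrite lee_fin mulr_ge0 ?powR_ge0].
  by apply: lee_wpmul2l; [rewrite lee_fin mulr_ge0 ?powR_ge0|exact: Iy].
apply: (@le_lt_trans _ _ (\int[mu]_(s in `[0%R, T])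
  ((heat_bound_cst t * Ky)%:E * (`|s - t| `^ (- (3 / 4)))%:E))%E).
  apply: ge0_le_integral => //.
  - by move=> s _; apply: integral_ge0 => y _; rewrite lee_fin sqr_ge0.
  - apply: measurable_funTS.
    apply: (measurable_integral_param mu _ ms2) => //.
    by move=> z; rewrite lee_fin sqr_ge0.
  - exact: (measurable_funTS (mcpow _ _ _)).
  move=> s; rewrite /= in_itv/= => /andP[s0 _].
  by rewrite (le_trans (bs s s0))// -!EFinM lee_fin mulrAC.
rewrite ge0_integralZl; [|exact: measurable_itv|exact: (measurable_funTS (mpow _ _))
  |by move=> y _; rewrite lee_fin powR_ge0|by rewrite lee_fin mulr_ge0].
apply: (@le_lt_trans _ _ ((heat_bound_cst t * Ky)%:E * Kt%:E)%E).
  apply: lee_wpmul2l => //.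
  by rewrite lee_fin mulr_ge0.
by rewrite -EFinM ltry.
Qed.

End fixed.
End HeatKernelL2.

(** * Step functions and L2 norms on the plane *)

Section SquareSum.
Local Open Scope ereal_scope.

(** Expands the square along a Gram matrix [K]. It is applied both to indicators of rectangles on
    the plane and to values of the sheet; their Gram matrices coincide, which is the isometry on
    step functions. *)
Lemma integral_sqr_sum d (T : measurableType d) (R : realType)
    (m : {measure set T -> \bar R}) (I : eqType) (s : seq I) (c : I -> R)
    (X : I -> T -> R) (K : I -> I -> R) :
  (forall p q, p \in s -> q \in s ->
     m.-integrable setT (fun w => (X p w * X q w)%:E) /\
     \int[m]_w (X p w * X q w)%:E = (K p q)%:E) ->
  \int[m]_w ((\sum_(p <- s) c p * X p w) ^+ 2)%:E =
  (\sum_(p <- s) \sum_(q <- s) c p * c q * K p q)%:E.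
Proof.
move=> XK.
(* Integrability is known only for members of the list, whereas integrating the sum termwise asks
   for it at every index. *)
pose h p q w : \bar R :=
  if (p \in s) && (q \in s) then (c p * c q)%:E * (X p w * X q w)%:E else 0.
have ih p q : m.-integrable setT (h p q).
  have [/andP[ps qs]|/negbTE pqs] := boolP ((p \in s) && (q \in s)).
    rewrite /h ps qs/=; apply: integrableZl => //.
    by have [] := XK p q ps qs.
  by rewrite /h pqs; exact: integrable0.
transitivity (\int[m]_w (\sum_(p <- s) \sum_(q <- s) h p q w)).
  apply: eq_integral => w _; rewrite expr2 big_distrlr/= -sumEFin.
  apply: eq_big_seq => p ps; rewrite -sumEFin; apply: eq_big_seq => q qs.
  by rewrite /h ps qs -EFinM; congr EFin; ring.
rewrite integral_sum//; last by move=> p; exact: integrable_sum.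
rewrite -sumEFin; apply: eq_big_seq => p ps.
rewrite integral_sum// -sumEFin; apply: eq_big_seq => q qs.
have [i e] := XK p q ps qs.
by rewrite /h ps qs/= integralZl// e -EFinM.
Qed.

End SquareSum.

Section PlaneSteps.
Local Open Scope ereal_scope.
Variable R : realType.
Local Notation mu := (@lebesgue_measure R).
Implicit Types (T : R) (st : seq (R * R * R)).

Lemma measurable_domainT T : measurable (domainT T : set (R * R)).
Proof. by apply: measurableX; exact: measurable_itv. Qed.

Lemma measurable_step_fun st : measurable_fun setT (step_fun st).
Proof.
apply: measurable_sum => p; apply: measurable_funM => //.
apply: measurable_indic; apply: measurableX; exact: measurable_itv.
Qed.

Lemma step_fun_vanishes T st : step_on T st -> vanishes_off T (step_fun st).
Proof.
move=> sT z zT; rewrite /step_fun big_seq big1// => -[[a t] x] /sT.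
rewrite inE => -[/= + +]; rewrite !in_itv/= => /andP[_ tT] /andP[_ x1].
rewrite indicE memNset ?mulr0// => -[/=]; rewrite !in_itv/= => /andP[z0 zt] /andP[z0' zx].
by apply: zT; split => /=; rewrite in_itv/= ?z0 ?z0'/=; [exact: le_trans zt _|exact: le_trans zx _].
Qed.

Lemma integral_indic_rect (t x s y : R) : (0 <= t)%R -> (0 <= x)%R ->
  (0 <= s)%R -> (0 <= y)%R ->
  (mu \x mu).-integrable setT
    (fun z => (\1_(`[0%R, t] `*` `[0%R, x]) z * \1_(`[0%R, s] `*` `[0%R, y]) z)%:E) /\
  \int[mu \x mu]_z
    (\1_(`[0%R, t] `*` `[0%R, x]) z * \1_(`[0%R, s] `*` `[0%R, y]) z)%:E =
  (Num.min t s * Num.min x y)%:E.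
Proof.
move=> t0 x0 s0 y0.
set A := `[0%R, Num.min t s]%classic; set B := `[0%R, Num.min x y]%classic.
have E z : (\1_(`[0%R, t] `*` `[0%R, x]) z * \1_(`[0%R, s] `*` `[0%R, y]) z : R)%R =
    \1_(A `*` B : set (R * R)) z.
  rewrite !indicE !in_setX !mem_setE !in_itv/= !le_min -natrM mulnb; congr ((_%:R)%R).
  by case: (0 <= z.1)%R (0 <= z.2)%R (z.1 <= t)%R (z.1 <= s)%R (z.2 <= x)%R (z.2 <= y)%R
    => -[] [] [] [] [].
have mAB : measurable (A `*` B : set (R * R)).
  by apply: measurableX; exact: measurable_itv.
have I : \int[mu \x mu]_z
    (\1_(`[0%R, t] `*` `[0%R, x]) z * \1_(`[0%R, s] `*` `[0%R, y]) z)%:E =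
    (Num.min t s * Num.min x y)%:E.
  under eq_integral do rewrite E.
  rewrite integral_indic// setIT.
  transitivity (mu A * mu B).
    by apply: product_measure1E; exact: measurable_itv.
  rewrite /A /B !lebesgue_measure_itv/= !lte_fin EFinM.
  have [a0|a0] := ltP 0%R (Num.min t s); last first.
    have -> : Num.min t s = 0%R by apply/eqP; rewrite eq_le a0 le_min t0 s0.
    by rewrite !mul0e.
  rewrite sube0; have [b0|b0] := ltP 0%R (Num.min x y); last first.
    have -> : Num.min x y = 0%R by apply/eqP; rewrite eq_le b0 le_min x0 y0.
    by rewrite !mule0.
  by rewrite sube0.
split => //; apply/integrableP; split.
  apply/measurable_EFinP; apply: measurable_funM; apply: measurable_indic;
    apply: measurableX; exact: measurable_itv.
under eq_integral do rewrite gee0_abs ?lee_fin ?mulr_ge0//.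
by rewrite I ltry.
Qed.

Lemma L2_sqnorm_prod T (f : R * R -> R) : measurable_fun setT f ->
  vanishes_off T f -> L2_sqnorm T f = \int[mu \x mu]_z (f z ^+ 2)%:E.
Proof.
move=> mf vf; rewrite L2_sqnorm_vanishes// fubini_tonelli1//.
- by apply/measurable_EFinP; exact: measurable_funX.
- by move=> z; rewrite lee_fin sqr_ge0.
Qed.

Lemma step_onP T st p : step_on T st -> p \in st ->
  [/\ (0 <= p.1.2)%R, (p.1.2 <= T)%R, (0 <= p.2)%R & (p.2 <= 1)%R].
Proof.
case: p => -[a t] x sT /sT; rewrite inE => -[/=].
by rewrite !in_itv/= => /andP[-> ->] /andP[-> ->].
Qed.

Lemma step_fun_sqnorm T st : step_on T st ->
  L2_sqnorm T (step_fun st) =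
  (\sum_(p <- st) \sum_(q <- st) p.1.1 * q.1.1 *
     (Num.min p.1.2 q.1.2 * Num.min p.2 q.2))%:E.
Proof.
move=> sT; rewrite L2_sqnorm_prod; [|exact: measurable_step_fun|exact: step_fun_vanishes].
apply: (@integral_sqr_sum _ _ _ (mu \x mu) _ st (fun p => p.1.1)
  (fun p => \1_(`[0%R, p.1.2]%classic `*` `[0%R, p.2]%classic))
  (fun p q => Num.min p.1.2 q.1.2 * Num.min p.2 q.2)%R) => p q ps qs.
have [? _ ? _] := step_onP sT ps; have [? _ ? _] := step_onP sT qs.
exact: integral_indic_rect.
Qed.

Lemma L2_sqnorm_patch T (f : R * R -> R) :
  L2_sqnorm T f = L2_sqnorm T (f \_ (domainT T)).
Proof.
apply: eq_integral => s sT; apply: eq_integral => y y1.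
by rewrite patchE mem_set// ; split; rewrite -inE.
Qed.

Lemma patch_vanishes T (f : R * R -> R) : vanishes_off T (f \_ (domainT T)).
Proof. by move=> z zT; rewrite patchE memNset. Qed.

Lemma measurable_patch_domainT T (f : R * R -> R) : measurable_fun (domainT T) f ->
  measurable_fun setT (f \_ (domainT T)).
Proof. by move=> mf; apply/(measurable_restrictT _ (measurable_domainT T)). Qed.

Lemma sqrrD_le (a b : R) : ((a + b) ^+ 2 <= 2 * a ^+ 2 + 2 * b ^+ 2)%R.
Proof. by have := sqr_ge0 (a - b); rewrite sqrrB sqrrD; lra. Qed.

Lemma integral_sqrD_le d (S : measurableType d) (m : {measure set S -> \bar R})
    (f g : S -> R) : measurable_fun setT f -> measurable_fun setT g ->
  \int[m]_w ((f w + g w) ^+ 2)%:E <=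
  2%:E * \int[m]_w (f w ^+ 2)%:E + 2%:E * \int[m]_w (g w ^+ 2)%:E.
Proof.
move=> mf mg.
have msq (h : S -> R) : measurable_fun setT h ->
    measurable_fun setT (fun w => (h w ^+ 2)%:E).
  by move=> mh; apply/measurable_EFinP; exact: measurable_funX.
have sq0 (h : S -> R) w : 0 <= (h w ^+ 2)%:E by rewrite lee_fin sqr_ge0.
have m2 (h : S -> R) : measurable_fun setT h ->
    measurable_fun setT (fun w => 2%:E * (h w ^+ 2)%:E).
  by move=> mh; apply: emeasurable_funM => //; exact: msq.
have p2 (h : S -> R) w : 0 <= 2%:E * (h w ^+ 2)%:E by rewrite mule_ge0.
rewrite -ge0_integralZl//; [|exact: msq].
rewrite -ge0_integralZl//; [|exact: msq].
rewrite -ge0_integralD//; [|exact: m2|exact: m2].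
apply: ge0_le_integral; [by []|by move=> w _; rewrite lee_fin sqr_ge0|
  exact: (msq _ (measurable_funD mf mg))|
  exact: emeasurable_funD (m2 f mf) (m2 g mg)|].
by move=> w _; rewrite -!EFinM -EFinD lee_fin sqrrD_le.
Qed.

Lemma L2_sqnormD_le T (f g : R * R -> R) :
  measurable_fun (domainT T) f -> measurable_fun (domainT T) g ->
  L2_sqnorm T (fun z => f z + g z)%R <=
  2%:E * L2_sqnorm T f + 2%:E * L2_sqnorm T g.
Proof.
move=> mf mg; rewrite (L2_sqnorm_patch T f) (L2_sqnorm_patch T g) L2_sqnorm_patch.
have vp := @patch_vanishes T; have mp := @measurable_patch_domainT T.
rewrite !L2_sqnorm_prod//; try exact: mp; last first.
  by apply: mp; exact: measurable_funD.
have hle := @integral_sqrD_le _ _ (mu \x mu) _ _ (mp _ mf) (mp _ mg).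
apply: le_trans hle.
rewrite le_eqVlt; apply/orP; left; apply/eqP; apply: eq_integral => z _.
by rewrite !patchE; case: ifP => // _; rewrite addr0.
Qed.

Lemma L2_sqnormZ T (a : R) (f : R * R -> R) : measurable_fun (domainT T) f ->
  L2_sqnorm T (fun z => a * f z)%R = (a ^+ 2)%:E * L2_sqnorm T f.
Proof.
move=> mf; rewrite (L2_sqnorm_patch T f) L2_sqnorm_patch.
have vp := @patch_vanishes T; have mp := @measurable_patch_domainT T.
rewrite !L2_sqnorm_prod//; try exact: mp; last first.
  by apply: mp; exact: measurable_funM.
rewrite -ge0_integralZl//.
- apply: eq_integral => z _; rewrite !patchE -EFinM; case: ifP => // _.
    by rewrite exprMn.
  by rewrite expr0n mulr0.
- by apply/measurable_EFinP; apply: measurable_funX; exact: mp.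
- by move=> z _; rewrite lee_fin sqr_ge0.
- by rewrite lee_fin sqr_ge0.
Qed.

End PlaneSteps.

(** * Wiener integrals against the sheet *)

Section WienerL2.
Local Open Scope ereal_scope.
Context {R : realType} {d : measure_display} {Omega : measurableType d}
        (P : probability Omega R).
Implicit Types (T : R) (N : R -> R -> {RV P >-> R}) (st : seq (R * R * R)).
Implicit Types (f g : R * R -> R) (Z : Omega -> R).

Lemma expectationE (X : Omega -> R) : 'E_P[X] = \int[P]_w (X w)%:E.
Proof. by rewrite unlock. Qed.

Lemma measurable_step_integral N st : measurable_fun setT (step_integral N st).
Proof. by apply: measurable_sum => p; exact: measurable_funM. Qed.

Lemma step_integral_cat N st st' w :
  step_integral N (st ++ st') w = (step_integral N st w + step_integral N st' w)%R.
Proof. by rewrite /step_integral big_cat. Qed.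

Lemma step_fun_cat st st' z :
  step_fun (st ++ st') z = (step_fun st z + step_fun st' z)%R.
Proof. by rewrite /step_fun big_cat. Qed.

Definition step_scale (a : R) st := [seq (a * p.1.1, p.1.2, p.2)%R | p <- st].

Lemma step_integral_scale N a st w :
  step_integral N (step_scale a st) w = (a * step_integral N st w)%R.
Proof.
rewrite /step_integral big_map mulr_sumr; apply: eq_bigr => p _ /=.
by rewrite mulrA.
Qed.

Lemma step_fun_scale a st z : step_fun (step_scale a st) z = (a * step_fun st z)%R.
Proof.
rewrite /step_fun big_map mulr_sumr; apply: eq_bigr => p _ /=.
by rewrite mulrA.
Qed.

Lemma step_on_cat_scale T a st st' : step_on T st -> step_on T st' ->
  step_on T (step_scale a st ++ st').
Proof.
move=> h h' b t x; rewrite mem_cat => /orP[/mapP[[[c s] y] /h hc [_ -> ->]]|/h']//.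
Qed.

Variables (T : R) (W : R -> R -> {RV P >-> R}).
Hypothesis hW : brownian_sheet T W.

Lemma sheet_step_isometry st : step_on T st ->
  \int[P]_w (step_integral W st w ^+ 2)%:E = L2_sqnorm T (step_fun st).
Proof.
move=> sT; rewrite (step_fun_sqnorm sT).
case: hW => _ cov _.
have covE (p q : R * R * R) : p \in st -> q \in st ->
    \int[P]_w (W p.1.2 p.2 w * W q.1.2 q.2 w)%:E =
    (Num.min p.1.2 q.1.2 * Num.min p.2 q.2)%:E.
  case: p => -[a t] x; case: q => -[b s] y /sT tx /sT sy.
  by rewrite -(cov t x s y tx sy) expectationE.
have sqi (p : R * R * R) : p \in st ->
    P.-integrable setT (fun w => (W p.1.2 p.2 w ^+ 2)%:E).
  move=> ps; apply/integrableP; split.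
    by apply/measurable_EFinP; exact: measurable_funX.
  under eq_integral do rewrite gee0_abs ?lee_fin ?sqr_ge0// expr2.
  by rewrite covE// ltry.
apply: (@integral_sqr_sum _ _ _ P _ st (fun p => p.1.1)
  (fun p => W p.1.2 p.2 : Omega -> R)
  (fun p q => Num.min p.1.2 q.1.2 * Num.min p.2 q.2)%R) => p q ps qs.
split; last exact: covE.
have hs := integrableD measurableT (sqi p ps) (sqi q qs).
(* A finite expectation does not by itself make the product integrable; the bound |xy| <= x^2 + y^2
   does. *)
apply: (le_integrable measurableT _ _ hs).
  by apply/measurable_EFinP; exact: measurable_funM.
move=> w _ /=; rewrite lee_fin.
move: (W _ _ w) (W _ _ w) => x y.
rewrite [leRHS]ger0_norm ?addr_ge0 ?sqr_ge0// ler_norml; apply/andP; split.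
  by have := sqr_ge0 (x + y); rewrite sqrrD; have := sqr_ge0 x; have := sqr_ge0 y; lra.
by have := sqr_ge0 (x - y); rewrite sqrrB; have := sqr_ge0 x; have := sqr_ge0 y; lra.
Qed.

(** The relation [is_wiener_integral] for the sheet with Z a bare function, so that linear
    combinations need not be bundled as random variables. *)
Definition sheet_limit f Z : Prop :=
  exists st : nat -> seq (R * R * R),
  [/\ forall n, step_on T (st n),
      L2_sqnorm T (fun z => step_fun (st n) z - f z)%R @[n --> \oo] --> 0 &
      \int[P]_w ((step_integral W (st n) w - Z w) ^+ 2)%:E @[n --> \oo] --> 0].

Lemma wiener_integral_sheet_limit f (Z : {RV P >-> R}) :
  is_wiener_integral T (@L2_sqnorm R T) W f Z -> sheet_limit f Z.
Proof.
move=> [st [sT q e]]; exists st; split => //.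
by under eq_fun do rewrite -expectationE.
Qed.

Lemma L2_sqnorm_ge0 f : 0 <= L2_sqnorm T f.
Proof.
by apply: integral_ge0 => s _; apply: integral_ge0 => y _; rewrite lee_fin sqr_ge0.
Qed.

Lemma integral_sqr_ge0 Z : 0 <= \int[P]_w (Z w ^+ 2)%:E.
Proof. by apply: integral_ge0 => w _; rewrite lee_fin sqr_ge0. Qed.

Lemma squeeze_combination (u v : (\bar R)^nat) (x : (\bar R)^nat) (a b : R) :
  (0 <= a)%R -> (0 <= b)%R ->
  (forall n, 0 <= x n <= a%:E * u n + b%:E * v n) ->
  u @ \oo --> 0 -> v @ \oo --> 0 -> x @ \oo --> 0.
Proof.
move=> a0 b0 xle u0 v0.
apply: (@squeeze_cvge _ _ _ _ (cst 0) _ (fun n => a%:E * u n + b%:E * v n)).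
- exact: nearW.
- exact: cvg_cst.
have -> : 0 = a%:E * 0 + b%:E * 0 :> \bar R by rewrite !mule0 adde0.
by apply: cvgeD => //; apply: cvgeZl.
Qed.

Lemma sheet_limit0 : sheet_limit (fun=> 0%R) (fun=> 0%R).
Proof.
exists (fun=> [::]); split => //.
- rewrite (_ : (fun _ => _) = cst 0); first exact: cvg_cst.
  apply/funext => n; apply: integral0_eq => s _; apply: integral0_eq => y _.
  by rewrite /step_fun big_nil subrr expr0n.
- rewrite (_ : (fun _ => _) = cst 0); first exact: cvg_cst.
  apply/funext => n; apply: integral0_eq => w _.
  by rewrite /step_integral big_nil subrr expr0n.
Qed.

(** Stands in for linearity of [IW]: scaled and concatenated approximating lists approximate the
    combination on both sides. *)
Lemma sheet_limit_linear a f g Z Z' :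
  measurable_fun (domainT T) f -> measurable_fun (domainT T) g ->
  measurable_fun setT Z -> measurable_fun setT Z' ->
  sheet_limit f Z -> sheet_limit g Z' ->
  sheet_limit (fun z => a * f z + g z)%R (fun w => a * Z w + Z' w)%R.
Proof.
move=> mf mg mZ mZ' [st [sT q e]] [st' [sT' q' e']].
have a20 : (0 <= 2 * a ^+ 2)%R by rewrite mulr_ge0// sqr_ge0.
have ms s : measurable_fun (domainT T) (step_fun s).
  by apply: measurable_funTS; exact: measurable_step_fun.
have mi := measurable_step_integral W.
exists (fun n => step_scale a (st n) ++ st' n); split.
- by move=> n; exact: step_on_cat_scale.
- apply: (squeeze_combination (b := 2) a20 _ _ q q') => // n.
  rewrite L2_sqnorm_ge0/=.
  rewrite [X in L2_sqnorm T X](_ : _ = (fun z => a * (step_fun (st n) z - f z) +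
    (step_fun (st' n) z - g z))%R); last first.
    by apply/funext => z; rewrite step_fun_cat step_fun_scale; ring.
  apply: le_trans (L2_sqnormD_le _ _) _.
  + by apply: measurable_funM => //; exact: measurable_funB.
  + exact: measurable_funB.
  rewrite L2_sqnormZ; last exact: measurable_funB.
  by rewrite [(2 * a ^+ 2)%:E]EFinM -muleA.
- apply: (squeeze_combination (b := 2) a20 _ _ e e') => // n.
  rewrite integral_sqr_ge0/=.
  under eq_integral => w _.
    rewrite step_integral_cat step_integral_scale.
    rewrite (_ : (_ - _)%R = (a * (step_integral W (st n) w - Z w) +
      (step_integral W (st' n) w - Z' w))%R); last by ring.
    over.
  apply: le_trans (integral_sqrD_le _ _ _) _.
  + by apply: measurable_funM => //; exact: measurable_funB.
  + exact: measurable_funB.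
  rewrite leeD2r// [(2 * a ^+ 2)%:E]EFinM -muleA lee_pmul2l//.
  rewrite -ge0_integralZl//.
  + by under eq_integral do rewrite exprMn EFinM.
  + by apply/measurable_EFinP; apply: measurable_funX; exact: measurable_funB.
  + by move=> w _; rewrite lee_fin sqr_ge0.
  + by rewrite lee_fin sqr_ge0.
Qed.

(** A weak form of the isometry. Passing from Z to a step integral and from the step function back
    to f costs a factor 2 each, by (a+b)^2 <= 2a^2 + 2b^2; the error terms vanish in the limit. *)
Lemma sheet_limit_sqnorm_le f Z :
  measurable_fun (domainT T) f -> measurable_fun setT Z -> sheet_limit f Z ->
  \int[P]_w (Z w ^+ 2)%:E <= 4%:E * L2_sqnorm T f.
Proof.
move=> mf mZ [st [sT q e]].
have mi := measurable_step_integral W.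
have ms s : measurable_fun (domainT T) (step_fun s).
  by apply: measurable_funTS; exact: measurable_step_fun.
have L0 := L2_sqnorm_ge0 f.
have H24 (A B : \bar R) : 0 <= A -> 0 <= B ->
    2%:E * (2%:E * A + 2%:E * B) = 4%:E * A + 4%:E * B.
  move=> A0 B0; rewrite ge0_muleDr ?mule_ge0// !muleA -EFinM.
  by rewrite (_ : (2 * 2 = 4 :> R)%R)//; ring.
have bound n : \int[P]_w (Z w ^+ 2)%:E <=
    2%:E * (\int[P]_w ((step_integral W (st n) w - Z w) ^+ 2)%:E) +
    4%:E * L2_sqnorm T (fun z => step_fun (st n) z - f z)%R + 4%:E * L2_sqnorm T f.
  under eq_integral => w _.
    rewrite (_ : (Z w ^+ 2)%R = ((- (step_integral W (st n) w - Z w) +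
      step_integral W (st n) w) ^+ 2)%R); last by congr (_ ^+ 2)%R; ring.
    over.
  apply: le_trans (integral_sqrD_le _ _ _) _; [|exact: mi|].
    by apply: measurable_funN; exact: measurable_funB.
  under eq_integral do rewrite sqrrN.
  rewrite -addeA leeD2l// sheet_step_isometry//.
  rewrite -(H24 _ _ (L2_sqnorm_ge0 (fun z => step_fun (st n) z - f z)%R) L0).
  rewrite lee_pmul2l//.
  rewrite [X in L2_sqnorm T X <= _](_ : _ =
    (fun z => (step_fun (st n) z - f z) + f z)%R); last first.
    by apply/funext => z; rewrite subrK.
  by apply: L2_sqnormD_le => //; exact: measurable_funB.
have [Loo|Lfin] := eqVneq (L2_sqnorm T f) +oo.
  by rewrite Loo gt0_muley ?leey// lte_fin.
have Lf : 4%:E * L2_sqnorm T f \is a fin_num.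
  by rewrite fin_numM// ge0_fin_numE// ltey.
pose u n := 2%:E * (\int[P]_w ((step_integral W (st n) w - Z w) ^+ 2)%:E) +
    4%:E * L2_sqnorm T (fun z => step_fun (st n) z - f z)%R.
have u0 : u @ \oo --> 0.
  apply: (squeeze_combination (a := 2) (b := 4) _ _ _ e q) => // n.
  by rewrite lexx andbT /u adde_ge0// mule_ge0 ?integral_sqr_ge0 ?L2_sqnorm_ge0.
have uL : (u n + 4%:E * L2_sqnorm T f) @[n --> \oo] --> 0 + 4%:E * L2_sqnorm T f.
  by apply: cvgeD => //; exact: cvg_cst.
rewrite add0e in uL.
rewrite -(cvg_lim _ uL)//; apply: lime_ge; first by apply/cvg_ex; eexists; exact: uL.
by apply: nearW => n; exact: bound.
Qed.

End WienerL2.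

(** * K* on signed integrands *)

Section SignedKstar.
Local Open Scope ereal_scope.
Variable R : realType.
Local Notation mu := (@lebesgue_measure R).
Variables CH H T : R.
Hypotheses (CH0 : (0 < CH)%R) (H12 : (2^-1 < H)%R) (H1 : (H < 1)%R).
Hypotheses (T0 : (0 < T)%R) (hCH : KH_normalization CH H).
Local Notation Kstar := (Kstar CH H).

(** Since [dKH] is nonnegative, the parts of phi times [dKH] are the parts of phi times [dKH]; the
    definition of the integral then gives the identity at every w, whether or not the values are
    finite. *)
Lemma Kstar_signed (phi : R * R -> R) w :
  Kstar phi w = Kstar (phi^\+)%R w - Kstar (phi^\-)%R w.
Proof.
rewrite /Kstar [LHS]integralE; congr (_ - _); apply: eq_integral => u _.
  rewrite funeposE -EFin_max; congr EFin; rewrite /funrpos maxr_pMl ?dKH_ge0//.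
  by rewrite mul0r.
rewrite funenegE -EFinN -EFin_max; congr EFin; rewrite /funrneg maxr_pMl ?dKH_ge0//.
by rewrite mul0r mulNr.
Qed.

Lemma measurable_fine_Kstar (phi : R * R -> R) : measurable_fun setT phi ->
  measurable_fun setT (fun w => fine (Kstar phi w)).
Proof.
move=> mphi; apply: measurableT_comp => //.
apply: (eq_measurable_fun (fun w => Kstar (phi^\+)%R w - Kstar (phi^\-)%R w)).
  by move=> w _; rewrite -Kstar_signed.
apply: emeasurable_funB; apply: measurable_Kstar => //.
- exact: measurable_funrpos.
- exact: measurable_funrneg.
Qed.

(* [fine (a - b)] is 0 when a or b is infinite. *)
Lemma fine_sub_sqr_le (a b : \bar R) : 0 <= a -> 0 <= b ->
  (fine (a - b) ^+ 2)%:E <= a * a + b * b.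
Proof.
case: a => [a| |]; case: b => [b| |]//= a0 b0; rewrite ?expr0n/=.
- rewrite -!EFinM -EFinD lee_fin; rewrite !lee_fin in a0 b0.
  by have := mulr_ge0 a0 b0; rewrite sqrrB; lra.
- by rewrite mulyy addey ?leey.
- by rewrite mulyy addye ?leey.
- by rewrite mulyy.
Qed.

Section signed.
Variable phi : R * R -> R.
Hypotheses (mphi : measurable_fun setT phi) (vphi : vanishes_off T phi).
Hypothesis L2phi : L2_sqnorm T phi < +oo.

Lemma energy_norm_lty :
  energy H (fun z => `|phi z|%R) (fun z => `|phi z|%R) < +oo.
Proof.
apply: (energy_lty (T := T) H12 H1).
- exact: measurableT_comp.
- by move=> z; exact: normr_ge0.
- by move=> z /vphi ->; rewrite normr0.
suff E : L2_sqnorm T (fun z => `|phi z|%R) = L2_sqnorm T phi by rewrite E.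
apply: eq_integral => s _; apply: eq_integral => y _.
by rewrite real_normK ?num_real.
Qed.

Lemma HT_sqnorm_fine_Kstar : HT_sqnorm H T phi =
  \int[mu \x mu]_w (fine (Kstar phi w) ^+ 2)%:E.
Proof.
rewrite (HT_sqnorm_Kstar CH0 H12 H1 T0 hCH mphi vphi energy_norm_lty).
have mK := @measurable_fine_Kstar.
have mp : measurable_fun setT (Kstar (phi^\+)%R).
  by apply: measurable_Kstar => //; exact: measurable_funrpos.
have mn : measurable_fun setT (Kstar (phi^\-)%R).
  by apply: measurable_Kstar => //; exact: measurable_funrneg.
apply: ae_eq_integral; first by [].
- apply/measurable_EFinP; apply: measurable_funX; apply: measurable_funB;
    exact: measurableT_comp.
- by apply/measurable_EFinP; apply: measurable_funX; exact: mK.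
have [N [mN N0 hN]] := Kstar_fin_num CH0 H12 H1 T0 hCH mphi vphi energy_norm_lty.
exists N; split => // w wN; apply: hN => -[hp hn]; apply: wN => _ /=.
by rewrite [in RHS]Kstar_signed [in RHS](fineB hp hn).
Qed.

Lemma fine_Kstar_sqr_lty :
  \int[mu \x mu]_w (fine (Kstar phi w) ^+ 2)%:E < +oo.
Proof.
have mK := measurable_fine_Kstar mphi.
have mp : measurable_fun setT (Kstar (phi^\+)%R).
  by apply: measurable_Kstar => //; exact: measurable_funrpos.
have mn : measurable_fun setT (Kstar (phi^\-)%R).
  by apply: measurable_Kstar => //; exact: measurable_funrneg.
apply: le_lt_trans (Kstar_sqr_lty CH0 H12 H1 T0 hCH mphi vphi energy_norm_lty).
apply: ge0_le_integral; [by []|by move=> w _; rewrite lee_fin sqr_ge0| | |].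
- by apply/measurable_EFinP; apply: measurable_funX; exact: mK.
- exact: (emeasurable_funD (emeasurable_funM mp mp) (emeasurable_funM mn mn)).
- move=> w _; rewrite Kstar_signed.
  exact: fine_sub_sqr_le (Kstar_ge0 _ CH0 (funrpos_ge0 phi) w)
    (Kstar_ge0 _ CH0 (funrneg_ge0 phi) w).
Qed.

(** Finiteness of [Kstar] on both parts of phi is integrability of |phi| against the kernel. This is
    where subtraction inside [Kstar] is allowed. *)
Lemma Kstar_integrable :
  {ae mu \x mu, forall w,
    mu.-integrable setT (fun u => (phi (u, w.1) * dKH CH H u w.2)%:E)}.
Proof.
have [N [mN N0 hN]] := Kstar_fin_num CH0 H12 H1 T0 hCH mphi vphi energy_norm_lty.
exists N; split => // w wN; apply: hN => -[hp hn]; apply: wN.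
have mk (f : R * R -> R) : measurable_fun setT f ->
    measurable_fun setT (fun u => (f (u, w.1) * dKH CH H u w.2)%:E).
  move=> mf; apply/measurable_EFinP; apply: measurable_funM.
    exact: measurable_pair2.
  exact: measurable_dKH2.
apply/integrableP; split; first exact: mk.
have mp := measurable_funrpos mphi; have mn := measurable_funrneg mphi.
have p0 (z : R * R) := funrpos_ge0 phi z; have n0 (z : R * R) := funrneg_ge0 phi z.
rewrite (_ : \int[mu]_u _ = Kstar (phi^\+)%R w + Kstar (phi^\-)%R w).
  by rewrite ltey_eq fin_numD hp hn.
rewrite /Kstar -ge0_integralD//=; first last.
- exact: mk.
- by move=> u _; rewrite lee_fin mulr_ge0// dKH_ge0.
- exact: mk.
- by move=> u _; rewrite lee_fin mulr_ge0// dKH_ge0.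
apply: eq_integral => u _; rewrite /= -EFinD normrM (ger0_norm (dKH_ge0 _ _ _ _))//.
rewrite -mulrDl; congr (_ * _)%:E.
exact: (congr1 (fun f => f (u, w.1)) (esym (funrposDneg phi))).
Qed.

End signed.
End SignedKstar.

(** * The images of step functions and of the heat kernel *)

Section Representation.
Local Open Scope ereal_scope.
Variable R : realType.
Local Notation mu := (@lebesgue_measure R).
Variables CH H T : R.
Hypotheses (CH0 : (0 < CH)%R) (H12 : (2^-1 < H)%R) (H1 : (H < 1)%R).
Hypotheses (T0 : (0 < T)%R) (hCH : KH_normalization CH H).
Local Notation Kstar := (Kstar CH H).
Local Notation rect t x := (\1_(`[0%R, t] `*` `[0%R, x]) : R * R -> R).

Lemma dKH_le0 (u s : R) : (s <= 0)%R -> dKH CH H u s = 0%R.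
Proof. by move=> s0; rewrite /dKH ltNge s0. Qed.

Lemma measurable_rect (t x : R) : measurable_fun setT (rect t x).
Proof. by apply: measurable_indic; apply: measurableX; exact: measurable_itv. Qed.

Lemma Kstar_rect (t x y s : R) : (0 <= s)%R ->
  Kstar (rect t x) (y, s) = (rect t x (s, y) * KH CH H t s)%:E.
Proof.
move=> s0; rewrite /Kstar/=; have [yx|yx] := boolP (y \in `[0%R, x]); last first.
  rewrite integral0_eq => [|u _]; rewrite indicE in_setX/= !mem_setE (negbTE yx) andbF.
    by rewrite mul0r.
  by rewrite mul0r.
transitivity (KH CH H t s)%:E.
  rewrite KH_integral// [RHS]integral_mkcond; apply: eq_integral => u _.
  rewrite patchE indicE in_setX/= !mem_setE yx andbT.
  by case: ifP; rewrite ?mul1r ?mul0r.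
rewrite indicE in_setX/= !mem_setE yx andbT in_itv/= s0/=.
by have [st|ts] := leP s t; rewrite ?mul1r// mul0r KH_lt.
Qed.

Lemma integrable_Kstar_rect (t x : R) w :
  mu.-integrable setT (fun u => (rect t x (u, w.1) * dKH CH H u w.2)%:E).
Proof.
have ge0 u : 0 <= (rect t x (u, w.1) * dKH CH H u w.2)%:E.
  by rewrite lee_fin mulr_ge0// dKH_ge0.
apply/integrableP; split.
  apply/measurable_EFinP; apply: measurable_funM; last exact: measurable_dKH2.
  by apply: measurable_pair2 => //; exact: measurable_rect.
under eq_integral do rewrite (gee0_abs (ge0 _)).
rewrite -/(Kstar (rect t x) w); case: w ge0 => y s ge0.
have [s0|s0] := leP 0%R s; first by rewrite Kstar_rect// ltry.
rewrite /Kstar integral0_eq// => u _.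
by rewrite dKH_le0 ?mulr0// ltW.
Qed.

Lemma Kstar_step (st : seq (R * R * R)) w :
  mu.-integrable setT (fun u => (step_fun st (u, w.1) * dKH CH H u w.2)%:E) /\
  Kstar (step_fun st) w =
    (\sum_(p <- st) p.1.1 * fine (Kstar (rect p.1.2 p.2) w))%:E.
Proof.
pose h (p : R * R * R) u :=
  (p.1.1)%:E * (rect p.1.2 p.2 (u, w.1) * dKH CH H u w.2)%:E.
have ih p : mu.-integrable setT (h p).
  by apply: integrableZl => //; exact: integrable_Kstar_rect.
have E u : (step_fun st (u, w.1) * dKH CH H u w.2)%:E = \sum_(p <- st) h p u.
  rewrite /step_fun mulr_suml -sumEFin; apply: eq_bigr => p _.
  by rewrite -mulrA EFinM.
split.
  by rewrite (funext E); exact: integrable_sum.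
rewrite /Kstar (funext E) integral_sum// -sumEFin; apply: eq_bigr => p _.
have iK := integrable_Kstar_rect p.1.2 p.2 w.
by rewrite /h integralZl// EFinM fineK//; exact: integrable_fin_num iK.
Qed.

Lemma Kstar_sub_step st (f : R * R -> R) w :
  mu.-integrable setT (fun u => (f (u, w.1) * dKH CH H u w.2)%:E) ->
  fine (Kstar (fun z => step_fun st z - f z)%R w) =
    (\sum_(p <- st) p.1.1 * fine (Kstar (rect p.1.2 p.2) w) - fine (Kstar f w))%R.
Proof.
move=> fi; have [si sE] := Kstar_step st w.
have ffin := integrable_fin_num measurableT fi.
rewrite {1}/Kstar; under eq_integral do rewrite mulrBl EFinB.
rewrite integralB_EFin// -/(Kstar _ w) sE -/(Kstar f w).
by rewrite -[X in _ - X](fineK ffin).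
Qed.

(** Bridges two conventions: [Kstar] puts the space variable first and lives on the whole plane,
    [L2_sqnorm] puts time first and sees only the domain, hence an inequality. *)
Lemma L2_sqnorm_swap_le (F : R * R -> R) : measurable_fun setT F ->
  L2_sqnorm T (fun z => F (z.2, z.1)) <= \int[mu \x mu]_w (F w ^+ 2)%:E.
Proof.
move=> mF.
have mF2 : measurable_fun setT (fun w => (F w ^+ 2)%:E).
  by apply/measurable_EFinP; exact: measurable_funX.
have F20 w : 0 <= (F w ^+ 2)%:E by rewrite lee_fin sqr_ge0.
have -> : \int[mu \x mu]_w (F w ^+ 2)%:E =
    \int[mu]_s fubini_G mu (fun w => (F w ^+ 2)%:E) s by exact: fubini_tonelli2.
rewrite /L2_sqnorm /=.
have mG := measurable_fun_fubini_tonelli_G (m1 := mu) _ mF2 F20.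
have G0 s : 0 <= fubini_G mu (fun w => (F w ^+ 2)%:E) s.
  exact: integral_ge0.
apply: (@le_trans _ _ (\int[mu]_(s in `[0%R, T]) fubini_G mu (fun w => (F w ^+ 2)%:E) s)).
  apply: ge0_le_integral.
  - exact: measurable_itv.
  - by move=> s _; exact: integral_ge0.
  - apply: measurable_funTS.
    apply: (measurable_integral_param mu (measurable_itv _)
      (f := fun w : R * R => (F (w.2, w.1) ^+ 2)%:E)).
      apply/measurable_EFinP; apply: measurable_funX; exact: measurable_pair2.
    by move=> z; exact: F20.
  - exact: measurable_funTS.
  move=> s _; rewrite /fubini_G; apply: ge0_subset_integral => //.
    apply/measurable_EFinP; apply: measurable_funX; exact: measurable_pair2.
apply: ge0_subset_integral => //; exact: measurable_itv.
Qed.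

Lemma rect_vanishes (t x : R) : (t, x) \in domainT T -> vanishes_off T (rect t x).
Proof.
rewrite inE => -[/= + +] z zT; rewrite !in_itv/= => /andP[_ tT] /andP[_ x1].
rewrite indicE memNset// => -[/=]; rewrite !in_itv/= => /andP[z0 zt] /andP[z0' zx].
by apply: zT; split => /=; rewrite in_itv/= ?z0 ?z0'/=;
  [exact: le_trans zt _|exact: le_trans zx _].
Qed.

(** K_H(t, .) is square integrable as the image of an indicator under the isometry; no direct
    estimate of its singularity is made. *)
Lemma rect_KH_in_L2 (t x : R) : (t, x) \in domainT T ->
  in_L2 T (fun z => \1_(`[0%R, t] `*` `[0%R, x]) z * KH CH H t z.1)%R.
Proof.
move=> txT; have mr := measurable_rect t x; have vr := rect_vanishes txT.
have rE z : domainT T z -> (\1_(`[0%R, t] `*` `[0%R, x]) z * KH CH H t z.1)%R =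
    fine (Kstar (rect t x) (z.2, z.1)).
  case: z => s y [/= + _]; rewrite in_itv/= => /andP[s0 _].
  by rewrite Kstar_rect.
have mK := @measurable_fine_Kstar R CH H CH0 _ mr.
split.
  apply: (eq_measurable_fun (fun z => fine (Kstar (rect t x) (z.2, z.1)))).
    by move=> z; rewrite inE => /rE.
  exact: measurable_funTS (measurable_pair2 mK measurable_snd measurable_fst).
have L2r : L2_sqnorm T (rect t x) < +oo.
  have sT : step_on T [:: (1, t, x)%R].
    by move=> a t' x'; rewrite mem_seq1 => /eqP[_ -> ->].
  have := step_fun_sqnorm sT.
  rewrite (_ : step_fun _ = rect t x) => [->|]; first exact: ltry.
  by apply/funext => z; rewrite /step_fun big_seq1/= mul1r.
apply: le_lt_trans (fine_Kstar_sqr_lty CH0 H12 H1 T0 hCH mr vr L2r).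
apply: le_trans (L2_sqnorm_swap_le mK).
rewrite le_eqVlt; apply/orP; left; apply/eqP.
apply: eq_integral => s sT; apply: eq_integral => y y1.
by rewrite rE//; split; rewrite -inE.
Qed.

Section heat.
Variables t x : R.
Hypotheses (t0 : (0 <= t)%R) (x01 : (0 <= x <= 1)%R).
Local Notation G := (heat_slice t x).

(** The slice vanishes after t and [dKH] vanishes before s, so the integral over the line reduces to
    the one over [s, t] defining M. *)
Lemma Mkernel_Kstar s y : (0 <= s)%R -> (0 <= y <= 1)%R ->
  (\1_(`[0%R, t] `*` `[0%R, 1%R]) (s, y) * Mkernel CH H t s x y)%R =
  fine (Kstar G (y, s)).
Proof.
move=> s0 y01; rewrite indicE in_setX/= !mem_setE !in_itv/= s0 y01 andbT.
have G0 u : (t < u)%R -> G (u, y) = 0%R.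
  by move=> tu; rewrite /heat_slice indicE in_setX/= mem_setE in_itv/= [(u <= t)%R]leNgt tu andbF/= mul0r.
have dK0 u : (u <= s)%R -> dKH CH H u s = 0%R.
  by move=> us; rewrite /dKH [(s < u)%R]ltNge us andbF.
have [st|ts] := leP s t; last first.
  rewrite mul0r /Kstar integral0_eq// => u _ /=.
  have [us|su] := leP u s; first by rewrite dK0// mulr0.
  by rewrite G0 ?mul0r// (lt_trans ts).
have FE u : (s < u)%R -> (u <= t)%R ->
    (heat_kernel (t - u) x y * derive1 (fun v : R => KH CH H v s) u)%R =
    (G (u, y) * dKH CH H u s)%R.
  move=> su ut; rewrite derive1_KH// /heat_slice indicE in_setX/= !mem_setE !in_itv/=.
  by rewrite ut y01 (le_trans s0 (ltW su)) mul1r.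
have mGK : measurable_fun setT (fun u => (G (u, y) * dKH CH H u s)%:E).
  apply/measurable_EFinP; apply: measurable_funM; last exact: measurable_dKH2.
  by apply: measurable_pair2 => //; exact: measurable_heat_slice.
rewrite mul1r /Mkernel /Rintegral; congr fine.
(* The two integrands may differ at u = s, where [derive1] is a junk value. *)
rewrite -integral_itv_obnd_cbnd; last first.
  apply: (eq_measurable_fun (fun u => (G (u, y) * dKH CH H u s)%:E)).
    by move=> u; rewrite mem_setE in_itv/= => /andP[su ut]; rewrite FE.
  exact: measurable_funTS.
rewrite /Kstar integral_mkcond; apply: eq_integral => u _ /=.
rewrite patchE mem_setE in_itv/=.
have [su|us] := ltP s u; last by rewrite dK0// mulr0.
by have [ut|tu] := leP u t; [rewrite FE|rewrite G0// mul0r].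
Qed.

Hypothesis tT : (t <= T)%R.

Lemma heat_slice_vanishes : vanishes_off T G.
Proof.
move=> z zT; rewrite /heat_slice indicE memNset ?mul0r// => -[/=].
rewrite !in_itv/= => /andP[z0 zt] z1; apply: zT; split => /=; rewrite in_itv//=.
by rewrite z0 (le_trans zt).
Qed.

Local Notation M := (fun z : R * R =>
  \1_(`[0%R, t] `*` `[0%R, 1%R]) z * Mkernel CH H t z.1 x z.2)%R.

Let ME z : domainT T z -> M z = fine (Kstar G (z.2, z.1)).
Proof.
case: z => s y [/=]; rewrite !in_itv/= => /andP[s0 _] y01.
exact: Mkernel_Kstar.
Qed.

Let mG : measurable_fun setT G. Proof. exact: measurable_heat_slice. Qed.
Let vG := heat_slice_vanishes.
Let L2G : L2_sqnorm T G < +oo. Proof. exact: heat_slice_L2. Qed.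

Lemma heat_slice_in_HT : in_HT H T G.
Proof.
split; first exact: measurable_funTS.
rewrite (@energyE _ H T (fun z => `|G z|%R) (fun z => `|G z|%R)) //.
- exact: (energy_norm_lty H12 H1 mG vG L2G).
- exact: measurableT_comp.
- exact: measurableT_comp.
- by move=> z /vG ->; rewrite normr0.
- by move=> z /vG ->; rewrite normr0.
Qed.

Lemma Mkernel_in_L2 : in_L2 T M.
Proof.
have mK := @measurable_fine_Kstar R CH H CH0 _ mG.
split.
  apply: (eq_measurable_fun (fun z => fine (Kstar G (z.2, z.1)))).
    by move=> z; rewrite inE => /ME.
  exact: measurable_funTS (measurable_pair2 mK measurable_snd measurable_fst).
apply: le_lt_trans (fine_Kstar_sqr_lty CH0 H12 H1 T0 hCH mG vG L2G).
apply: le_trans (L2_sqnorm_swap_le mK).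
rewrite le_eqVlt; apply/orP; left; apply/eqP.
apply: eq_integral => s sT; apply: eq_integral => y y1.
by rewrite ME//; split; rewrite -inE.
Qed.

(** By the isometry the right-hand side is the squared norm over the whole plane of the image of the
    difference; the left-hand side is its share over the domain. *)
Lemma step_sub_heat_le st : step_on T st ->
  L2_sqnorm T (fun z => \sum_(p <- st)
      p.1.1 * (\1_(`[0%R, p.1.2] `*` `[0%R, p.2]) z * KH CH H p.1.2 z.1) - M z)%R <=
  HT_sqnorm H T (fun z => step_fun st z - G z)%R.
Proof.
move=> sT; have ms := measurable_step_fun st.
have mphi : measurable_fun setT (fun z => step_fun st z - G z)%R.
  exact: measurable_funB.
have vphi : vanishes_off T (fun z => step_fun st z - G z)%R.
  by move=> z zT; rewrite (step_fun_vanishes sT zT) (vG zT) subrr.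
have L2phi : L2_sqnorm T (fun z => step_fun st z - G z)%R < +oo.
  apply: le_lt_trans (L2_sqnormD_le _ _) _.
  - exact: measurable_funTS.
  - by apply: measurable_funTS; exact: measurable_funN.
  rewrite (_ : L2_sqnorm T (fun z => - G z)%R = L2_sqnorm T G); last first.
    apply: eq_integral => s _; apply: eq_integral => y _.
    by rewrite sqrrN.
  apply: lte_add_pinfty; apply: lte_mul_pinfty; [by []|by []| |by []|by []|exact: L2G].
  by rewrite (step_fun_sqnorm sT) ltry.
rewrite (HT_sqnorm_fine_Kstar CH0 H12 H1 T0 hCH mphi vphi L2phi).
pose F w := (\sum_(p <- st) p.1.1 * fine (Kstar (rect p.1.2 p.2) w) -
  fine (Kstar G w))%R.
have mK f := @measurable_fine_Kstar R CH H CH0 f.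
have mF : measurable_fun setT F.
  apply: measurable_funB; last exact: mK.
  apply: measurable_sum => p; apply: measurable_funM => //.
  by apply: mK; exact: measurable_rect.
apply: (@le_trans _ _ (\int[mu \x mu]_w (F w ^+ 2)%:E)).
  apply: le_trans (L2_sqnorm_swap_le mF).
  rewrite le_eqVlt; apply/orP; left; apply/eqP.
  apply: eq_integral => s sT'; apply: eq_integral => y y1.
  have syT : domainT T (s, y) by split; rewrite -inE.
  congr ((_ ^+ 2)%:E); rewrite /F -(ME syT); congr (_ - _)%R.
  apply: eq_bigr => p _; rewrite Kstar_rect//.
  by case: syT => /=; rewrite in_itv/= => /andP[].
rewrite le_eqVlt; apply/orP; left; apply/eqP.
apply: ae_eq_integral; first by [].
- by apply/measurable_EFinP; exact: measurable_funX.
- by apply/measurable_EFinP; apply: measurable_funX; exact: mK.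
(* Off this null set [Kstar] of the difference is the difference of the images. *)
have [N [mN N0 hN]] := Kstar_integrable CH0 H12 H1 T0 hCH mG vG L2G.
exists N; split => // w wN; apply: hN => fi; apply: wN => _ /=.
by rewrite (Kstar_sub_step _ fi).
Qed.

End heat.
End Representation.

(** * Identification of the two integrals *)

Section SheetLimitSum.
Local Open Scope ereal_scope.
Context {R : realType} {d : measure_display} {Omega : measurableType d}
        (P : probability Omega R).
Variables (T : R) (W : R -> R -> {RV P >-> R}).

Lemma sheet_limit_sum (I : eqType) (s : seq I) (c : I -> R)
    (f : I -> R * R -> R) (Z : I -> {RV P >-> R}) (g : R * R -> R) (Y : Omega -> R) :
  (forall p, p \in s -> measurable_fun (domainT T) (f p) /\
     sheet_limit T W (f p) (Z p)) ->
  measurable_fun (domainT T) g -> measurable_fun setT Y -> sheet_limit T W g Y ->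
  measurable_fun (domainT T) (fun z => \sum_(p <- s) c p * f p z + g z)%R /\
  sheet_limit T W (fun z => \sum_(p <- s) c p * f p z + g z)%R
    (fun w => \sum_(p <- s) c p * Z p w + Y w)%R.
Proof.
move=> + mg mY gY; elim: s => [_|p s ih fZ].
  under eq_fun do rewrite big_nil add0r.
  by under [X in sheet_limit _ _ _ X]eq_fun do rewrite big_nil add0r.
have [q qs|ms ls] := ih; first by apply: fZ; rewrite inE qs orbT.
have [mf lf] := fZ p (mem_head _ _).
have E1 : (fun z => \sum_(p <- p :: s) c p * f p z + g z)%R =
    (fun z => c p * f p z + (\sum_(p <- s) c p * f p z + g z))%R.
  by apply/funext => z; rewrite big_cons addrA.
have E2 : (fun w => \sum_(p <- p :: s) c p * Z p w + Y w)%R =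
    (fun w => c p * Z p w + (\sum_(p <- s) c p * Z p w + Y w))%R.
  by apply/funext => z; rewrite big_cons addrA.
rewrite E1 E2; split.
  by apply: measurable_funD => //; exact: measurable_funM.
apply: sheet_limit_linear => //.
apply: measurable_funD => //; apply: measurable_sum => q.
exact: measurable_funM.
Qed.

Lemma ae_step_integral (B : R -> R -> {RV P >-> R})
    (Z : R * R * R -> {RV P >-> R}) (st : seq (R * R * R)) :
  (forall p, p \in st -> {ae P, forall w, B p.1.2 p.2 w = Z p w}) ->
  {ae P, forall w, step_integral B st w = \sum_(p <- st) p.1.1 * Z p w}%R.
Proof.
elim: st => [_|p st ih h].
  by apply: aeW => w; rewrite /step_integral !big_nil.
have h1 := h p (mem_head _ _).
have h2 : {ae P, forall w, step_integral B st w = \sum_(p <- st) p.1.1 * Z p w}%R.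
  by apply: ih => q qs; apply: h; rewrite inE qs orbT.
apply: filterS (filterI h1 h2) => w [e1 e2].
by move: e2; rewrite /step_integral !big_cons e1 => ->.
Qed.

End SheetLimitSum.

(** The memberships of G and M belong to the conclusion because [IB] and [IW] are specified only on
    [in_HT] and [in_L2]; they give the almost sure equality its meaning. *)
Theorem corollary3p3 (R : realType) (d : measure_display)
  (Omega : measurableType d) (P : probability Omega R)
  (Pcomplete : measure_is_complete P)
  (T H CH : R) (T0 : 0 < T) (H12 : 2^-1 < H) (H1 : H < 1)
  (hCH : KH_normalization CH H)
  (W : R -> R -> {RV P >-> R}) (hW : brownian_sheet T W)
  (IW : (R * R -> R) -> {RV P >-> R}) (hIW : sheet_integral T W IW)
  (B : R -> R -> {RV P >-> R})
  (hB : forall t x, (t, x) \in domainT T ->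
     {ae P, forall w, B t x w =
        IW (fun z => \1_(`[0, t] `*` `[0, x]) z * KH CH H t z.1) w})
  (IB : (R * R -> R) -> {RV P >-> R}) (hIB : noise_integral H T B IB)
  (X : R -> R -> {RV P >-> R})
  (hX : forall t x, (t, x) \in domainT T ->
     {ae P, forall w, X t x w =
        IB (fun z => \1_(`[0, t] `*` `[0, 1]) z
                       * heat_kernel (t - z.1) x z.2) w}) :
  forall t x, (t, x) \in domainT T ->
  let G := fun z : R * R => \1_(`[0, t] `*` `[0, 1]) z
                              * heat_kernel (t - z.1) x z.2 in
  let M := fun z : R * R => \1_(`[0, t] `*` `[0, 1]) z
                              * Mkernel CH H t z.1 x z.2 in
  [/\ in_HT H T G, in_L2 T M & {ae P, forall w, X t x w = IW M w}].
Proof.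
move=> t x txT G M.
have CH0 : 0 < CH by case: hCH.
have [t0 tT x01] : [/\ 0 <= t, t <= T & 0 <= x <= 1].
  by move: txT; rewrite inE => -[/=]; rewrite !in_itv/= => /andP[].
have GHT : in_HT H T G := heat_slice_in_HT H12 H1 t0 x01 tT.
have ML2 : in_L2 T M := Mkernel_in_L2 CH0 H12 H1 T0 hCH t0 x01 tT.
split => //.
have [st [stT stG stB]] := hIB _ GHT.
have lM := wiener_integral_sheet_limit (hIW _ ML2).
pose f (p : R * R * R) (z : R * R) :=
  \1_(`[0, p.1.2] `*` `[0, p.2]) z * KH CH H p.1.2 z.1.
(* This is -W(M), in the shape that [sheet_limit_linear] yields with factor -1 and the zero
   limit. *)
pose Y (w : Omega) := -1 * IW M w + 0.
have mY : measurable_fun setT Y.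
  by apply: measurable_funD => //; exact: measurable_funM.
have mg : measurable_fun (domainT T) (fun z => -1 * M z + 0).
  by apply: measurable_funD => //; apply: measurable_funM => //; case: ML2.
have lY : sheet_limit T W (fun z => -1 * M z + 0) Y.
  by apply: sheet_limit_linear => //; [case: ML2|exact: sheet_limit0].
(* The step integral against B is almost surely a finite combination of sheet integrals, so its
   difference with W(M) is a sheet limit for K* s_n - M. *)
have key n : (\int[P]_w ((step_integral B (st n) w - IW M w) ^+ 2)%:E <=
    4%:E * HT_sqnorm H T (fun z => step_fun (st n) z - G z)%R)%E.
  have fZ (p : R * R * R) : p \in st n -> measurable_fun (domainT T) (f p) /\
      sheet_limit T W (f p) (IW (f p)).
    case: p => -[a s] y /(stT n) syT.
    have fL2 := rect_KH_in_L2 CH0 H12 H1 T0 hCH syT.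
    split; first by case: fL2.
    exact: wiener_integral_sheet_limit (hIW _ fL2).
  have [mS lS] := sheet_limit_sum (fun p => p.1.1) fZ mg mY lY.
  have mZ : measurable_fun setT
      (fun w => \sum_(p <- st n) p.1.1 * IW (f p) w + Y w).
    by apply: measurable_funD => //; apply: measurable_sum => p; exact: measurable_funM.
  have := sheet_limit_sqnorm_le hW mS mZ lS.
  move=> le4; apply: (@le_trans _ _ (\int[P]_w
     ((\sum_(p <- st n) p.1.1 * IW (f p) w + Y w) ^+ 2)%:E)%E).
    rewrite le_eqVlt; apply/orP; left; apply/eqP; apply: ae_eq_integral => //.
    - apply/measurable_EFinP; apply: measurable_funX; apply: measurable_funB => //.
      exact: measurable_step_integral.
    - by apply/measurable_EFinP; exact: measurable_funX.
    have hst : {ae P, forall w, step_integral B (st n) w =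
        \sum_(p <- st n) p.1.1 * IW (f p) w}.
      by apply: ae_step_integral => -[[a s] y] /(stT n); exact: hB.
    by apply: filterS hst => w -> _; rewrite /Y mulN1r addr0.
  apply: le_trans le4 _; rewrite lee_pmul2l//.
  apply: le_trans (step_sub_heat_le CH0 H12 H1 T0 hCH t0 x01 tT (stT n)).
  rewrite le_eqVlt; apply/orP; left; apply/eqP.
  by congr (L2_sqnorm T _); apply/funext => z; rewrite mulN1r addr0.
have stB' : (\int[P]_w ((step_integral B (st n) w - IB G w) ^+ 2)%:E)%E @[n --> \oo]
    --> 0%E.
  by under eq_fun do rewrite -expectationE.
(* The step integral serves as intermediate point; 8 is 2 times the 4 of [key]. *)
have bnd n : (0 <= \int[P]_w ((IB G w - IW M w) ^+ 2)%:E <=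
    2%:E * (\int[P]_w ((step_integral B (st n) w - IB G w) ^+ 2)%:E) +
    8%:E * HT_sqnorm H T (fun z => step_fun (st n) z - G z)%R)%E.
  apply/andP; split; first by apply: integral_ge0 => w _; rewrite lee_fin sqr_ge0.
  under eq_integral => w _.
    rewrite (_ : (IB G w - IW M w) ^+ 2 = (- (step_integral B (st n) w - IB G w) +
      (step_integral B (st n) w - IW M w)) ^+ 2); last by congr (_ ^+ 2); ring.
    over.
  apply: le_trans (integral_sqrD_le _ _ _) _.
  - apply: measurable_funN; apply: measurable_funB => //.
    exact: measurable_step_integral.
  - by apply: measurable_funB => //; exact: measurable_step_integral.
  under eq_integral do rewrite sqrrN.
  rewrite leeD2l// (_ : 8%:E = (2%:E * 4%:E)%E :> \bar R); last first.
    by rewrite -EFinM; congr EFin; ring.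
  by rewrite -muleA lee_pmul2l//; exact: key.
have lim0 := squeeze_combination (a := 2) (b := 8) (ler0n _ 2) (ler0n _ 8) bnd stB' stG.
have E0 : (\int[P]_w ((IB G w - IW M w) ^+ 2)%:E = 0)%E.
  by rewrite -(cvg_lim _ lim0)// lim_cst.
have mD : measurable_fun setT (fun w => ((IB G w - IW M w) ^+ 2)%:E).
  by apply/measurable_EFinP; apply: measurable_funX; exact: measurable_funB.
have ae0 : {ae P, forall w, ((IB G w - IW M w) ^+ 2)%:E = 0%E}.
  have [ae0 _] := ae_eq_integral_abs P measurableT mD.
  have := ae0 _; under eq_integral do rewrite gee0_abs ?lee_fin ?sqr_ge0//.
  by move=> /(_ E0); apply: filterS => w /(_ Logic.I).
apply: filterS (filterI (hX _ _ txT) ae0) => w [-> []] /eqP.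
by rewrite sqrf_eq0 subr_eq0 => /eqP.
Qed.
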